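(* Let $\ell:\mathbb{N}\to[0,\infty)$ satisfy $\lim_{n\to\infty}\ell(n)=\infty$, and for each $n\in\mathbb{N}$ let $T_n$ be a tree on the vertex set $\{0,1,\ldots,n\}$ rooted at $0$. Let $L_{k,n}$ be the reduced-tree lengths of $T_n$, and let $C^0_{p(n)}$ be the size of the cluster containing the root in Bernoulli bond percolation on $T_n$ with parameter $p(n)$ (as defined in the context). For $c\ge 0$, say that a sequence $(p(n))_{n\in\mathbb{N}}$ in $[0,1]$ is in the regime $R(c)$ if $$p(n)=1-\frac{c}{\ell(n)}+o\left(\frac{1}{\ell(n)}\right)\qquad (n\to\infty).$$ (i) Suppose that for every $k\in\mathbb{N}$ there is a random variable $L_k$ with values in $[0,\infty)$ such that $\frac{1}{\ell(n)}L_{k,n}\Rightarrow L_k$ as $n\to\infty$. Then for every $c\ge 0$ and every sequence $(p(n))$ in the regime $R(c)$, $$n^{-1}C^0_{p(n)}\Rightarrow G(c)\qquad (n\to\infty),$$ where $G(c)\not\equiv 0$ is a random variable whose law is determined by its entire moments $$\mathbb{E}\left(G(c)^k\right)=\mathbb{E}\left(e^{-cL_k}\right),\qquad k\in\mathbb{N}.$$ In particular, $\lim_{c\to0+}G(c)=1$ in probability. (ii) Conversely, suppose that for every $c>0$ there is a random variable $G(c)$ with values in $[0,1]$ such that $n^{-1}C^0_{p(n)}\Rightarrow G(c)$ as $n\to\infty$ for every sequence $(p(n))$ in the regime $R(c)$. Suppose further that $\lim_{c\to0+}G(c)=1$ in probability. Then for every $k\ge1$ there is a random variable $L_k$ with values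 in $[0,\infty)$ such that $\frac{1}{\ell(n)}L_{k,n}\Rightarrow L_k$ as $n\to\infty$, and the Laplace transform of $L_k$ is given by $\mathbb{E}(e^{-cL_k})=\mathbb{E}(G(c)^k)$ for $c>0$.
   Context: For each $n\in\mathbb{N}=\{1,2,\ldots\}$, $T_n$ is a tree structure (deterministic or random) on the vertex set $\mathcal{V}_n=\{0,1,\ldots,n\}$, with root $0$; so $T_n$ has $n$ edges. Bernoulli bond percolation on $T_n$ with parameter $p(n)\in[0,1]$: each edge of $T_n$ is kept with probability $p(n)$ and removed with probability $1-p(n)$, independently of the other edges (conditionally on $T_n$ if $T_n$ is random). The resulting connected components are called clusters, the size of a cluster is its number of vertices, and $C^0_{p(n)}$ is the size of the cluster containing the root $0$. For each fixed $n$, let $V_1,V_2,\ldots$ be i.i.d. vertices uniformly distributed on $\mathcal{V}_n$ (independent of $T_n$ if it is random, and of the percolation). For $k\in\mathbb{N}$, $L_{k,n}$ is the length of the tree $T_n$ reduced to $V_1,\ldots,V_k$ and the root $0$, i.e. the minimal number of edges of $T_n$ needed to connect $0$ and $V_1,\ldots,V_k$. The symbol $\Rightarrow$ denotes weak convergence (convergence in distribution). For each $k$ separately, only convergence of one-dimensional distributions is involved. Expressions with $\ell(n)$ in the denominator are understood for $n$ large enough that $\ell(n)>0$. *)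

(* Defs.v *)
From HB Require Import structures.
From mathcomp Require Import all_boot all_order all_algebra.
From mathcomp Require Import all_classical all_reals all_analysis.

Set Implicit Arguments.
Unset Strict Implicit.
Unset Printing Implicit Defensive.

Import Order.TTheory GRing.Theory Num.Theory.
Import numFieldNormedType.Exports.

Local Open Scope classical_set_scope.
Local Open Scope ring_scope.

(* A real random variable bundled with the probability space it lives on, so
   that families of random variables on unrelated spaces can be quantified
   over. *)
Record randvar (R : realType) := RandVar {
  rv_disp : measure_display;
  rv_space : measurableType rv_disp;
  rv_prob : probability rv_space R;
  rv_fun :> {mfun rv_space >-> R} }.

Definition rv_scale (R : realType) (a : R) (X : randvar R) : randvar R :=
  RandVar (rv_prob X) (a *: rv_fun X).

(* E(f(X)) *)
Definition rv_expect (R : realType) (X : randvar R) (f : R -> R) : \bar R :=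
  'E_(rv_prob X)[f \o X].

Definition same_law (R : realType) (X Y : randvar R) : Prop :=
  forall A : set R, measurable A ->
    distribution (rv_prob X) X A = distribution (rv_prob Y) Y A.

Definition cvg_in_law (R : realType) (X : nat -> randvar R) (Y : randvar R) :
    Prop :=
  forall f : R -> R, continuous f -> bounded_fun f ->
    rv_expect (X n) f @[n --> \oo] --> rv_expect Y f.

(* convergence to the constant 1 in probability as the index decreases to 0;
   the variables may live on different spaces *)
Definition cvg_to_one_in_prob (R : realType) (G : R -> randvar R) : Prop :=
  forall eps : R, 0 < eps ->
    rv_prob (G c) [set w | eps < `|G c w - 1|] @[c --> 0^'+] --> 0%E.

(* Graphs on the vertex set {0, ..., n} are given by their sets of edges, an
   edge being the set of its two endpoints. *)
Definition edges (n : nat) := {set {set 'I_n.+1}}.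

Definition adj (n : nat) (F : edges n) : rel 'I_n.+1 :=
  [rel x y | [set x; y]%SET \in F].

(* [ucycle (adj t) c] also holds of a single edge traversed back and forth, a
   sequence c of length 2; genuine cycles have length at least 3. *)
Definition is_tree (n : nat) (t : edges n) : Prop :=
  [/\ forall e, e \in t -> #|e| = 2,
      forall x y, connect (adj t) x y
    & forall c : seq 'I_n.+1, ucycle (adj t) c -> (size c <= 2)%N].

(* The default value #|t| of the minimum is attained when t is a tree, since
   then F = t is one of the candidates. *)
Definition reduced_length (n : nat) (t : edges n) (s : seq 'I_n.+1) : nat :=
  \big[minn/#|t|]_(F : edges n |
      (F \subset t) && all (connect (adj F) ord0) s) #|F|.

Definition root_cluster_size (n : nat) (F : edges n) : nat :=
  #|[set v | connect (adj F) ord0 v]%SET|.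

(* A probability space carrying a random tree on {0, ..., n}, vertices
   V_1, V_2, ... (here [vertex 0], [vertex 1], ...), and for each parameter p
   the set [kept p] of edges that survive percolation.  A deterministic tree
   is the case of a constant [tree].  [joint_law] says that for p in [0, 1],
   given the tree, the edges are kept independently with probability p, and
   that the V_i are i.i.d. uniform and independent of the pair (tree, kept p).
   Nothing is assumed on the joint law of [kept p] for different values of
   p. *)
Record percolation_model (R : realType) (n : nat) := PercolationModel {
  pm_disp : measure_display;
  pm_space : measurableType pm_disp;
  pm_prob : probability pm_space R;
  tree : pm_space -> edges n;
  vertex : nat -> pm_space -> 'I_n.+1;
  kept : R -> pm_space -> edges n;
  measurable_tree : forall t : edges n, measurable (tree @^-1` [set t]);
  measurable_vertex : forall i v, measurable (vertex i @^-1` [set v]);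
  measurable_kept : forall p F, measurable (kept p @^-1` [set F]);
  treeP : forall w, is_tree (tree w);
  kept_sub : forall p w, kept p w \subset tree w;
  joint_law : forall (p : R) (t F : edges n) (s : seq 'I_n.+1),
    0 <= p <= 1 -> F \subset t ->
    pm_prob [set w | [/\ tree w = t, kept p w = F
                       & mkseq (vertex^~ w) (size s) = s]]
    = (pm_prob [set w | tree w = t] *
        ((\prod_(e in t) (if e \in F then p else 1 - p)) *
         \prod_(v <- s) n.+1%:R^-1)%:E)%E }.

Section model_random_variables.
Context (R : realType) (n : nat) (M : percolation_model R n).

Definition reduced_length_fun (k : nat) (w : pm_space M) : R :=
  (reduced_length (tree w) (mkseq ((@vertex _ _ M)^~ w) k))%:R.

Definition root_cluster_fun (p : R) (w : pm_space M) : R :=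
  (root_cluster_size (kept p w))%:R.

Lemma measurable_fin_fun (I : finType) (Z : pm_space M -> I) (g : I -> R) :
  (forall i, measurable (Z @^-1` [set i])) ->
  measurable_fun [set: pm_space M] (g \o Z).
Proof.
move=> mZ _ A _; rewrite setTI.
have -> : (g \o Z) @^-1` A =
    \bigcup_(i in [set i | A (g i)]) (Z @^-1` [set i]).
  apply/seteqP; split=> [w Aw | w [i Ai] Zwi] /=; first by exists (Z w).
  by rewrite Zwi.
by apply: fin_bigcup_measurable => // i _.
Qed.

Lemma measurable_reduced_length k :
  measurable_fun [set: pm_space M] (reduced_length_fun k).
Proof.
pose Z (w : pm_space M) := (tree w, [ffun i : 'I_k => vertex i w]).
pose g (z : edges n * {ffun 'I_k -> 'I_n.+1}) : R :=
  (reduced_length z.1 [seq z.2 i | i <- enum 'I_k])%:R.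
have -> : reduced_length_fun k = g \o Z.
  apply/funext => w; rewrite /reduced_length_fun /g /mkseq -val_enum_ord.
  rewrite -map_comp; congr ((reduced_length _ _)%:R).
  by apply: eq_map => i /=; rewrite ffunE.
apply: measurable_fin_fun => -[t f].
have -> : Z @^-1` [set (t, f)] =
    @tree _ _ M @^-1` [set t] `&`
    \bigcap_(i in [set: 'I_k]) (@vertex _ _ M i @^-1` [set f i]).
  apply/seteqP; split=> [w /= [<- <-] | w /= [<- fw]].
    by split=> // i _; rewrite /= ffunE.
  by congr pair; apply/ffunP => i; rewrite ffunE; apply: fw.
apply: measurableI; first exact: measurable_tree.
by apply: fin_bigcap_measurable => // i _; apply: measurable_vertex.
Qed.

Lemma measurable_root_cluster p :
  measurable_fun [set: pm_space M] (root_cluster_fun p).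
Proof.
apply: (@measurable_fin_fun _ (kept p) (fun F => (root_cluster_size F)%:R)).
by move=> F; apply: measurable_kept.
Qed.

HB.instance Definition _ k := @isMeasurableFun.Build _ _ _ _
  (reduced_length_fun k) (measurable_reduced_length k).

HB.instance Definition _ p := @isMeasurableFun.Build _ _ _ _
  (root_cluster_fun p) (measurable_root_cluster p).

(* L_{k,n} *)
Definition reduced_length_rv (k : nat) : randvar R :=
  RandVar (pm_prob M) (reduced_length_fun k).

(* C^0_p *)
Definition root_cluster_rv (p : R) : randvar R :=
  RandVar (pm_prob M) (root_cluster_fun p).

End model_random_variables.

(* Sequences are indexed by nat, but the values at 0 play no role. *)
Definition in_regime (R : realType) (ell : nat -> R) (c : R) (p : nat -> R) :
    Prop :=
  (forall n, (0 < n)%N -> 0 <= p n <= 1) /\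
  p = (fun n => 1 - c / ell n) +o_\oo (fun n => (ell n)^-1).

(* Main.v *)
(* Let L(t, s) be the least number of edges of a tree t joining the root to the
   vertices s. In a tree these edges are exactly the bridges separating the root
   from a vertex of s, so all of s lies in the root cluster iff each of these
   L(t, s) edges is kept. Averaging over uniform s gives the exact identity
     E ((C / (n + 1)) ^ k) = E (p ^ L_k),   C the size of the root cluster,
   and for p = exp (- c / ell n) the right-hand side is the Laplace transform of
   L_k / ell n at c. A general p in the regime R(c) lies eventually between
   exp (- (c + d) / ell n) and exp (- (c - d) / ell n). Both directions thus
   reduce to the moment problem on [0, 1]: Weierstrass approximation turns
   convergence of moments into convergence of E f for every continuous f, and
   Helly's construction provides the limit law. For the converse it is applied
   to exp (- L_k / ell n), whose moments are the values at integers of the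
   Laplace transform. *)
Require Import Defs.
From HB Require Import structures.
From mathcomp Require Import all_boot all_order all_algebra.
From mathcomp Require Import all_classical all_reals all_analysis.
From mathcomp Require Import measurable_realfun ring lra.

Set Implicit Arguments.
Unset Strict Implicit.
Unset Printing Implicit Defensive.

Import Order.TTheory GRing.Theory Num.Theory.
Import numFieldNormedType.Exports.

Local Open Scope classical_set_scope.
Local Open Scope ring_scope.

(** * Bridges of a tree *)

(** The exact identity concerns C / (n + 1), while the theorem normalizes by n. As C / n may exceed
    1, it is handled on [0, 2], and its moments differ from those of C / (n + 1) by the factor ((n +
    1) / n) ^ k, which tends to 1. The sandwich for p needs the limiting Laplace transform to be
    continuous in c. This reduces to continuity at 0, because exp (- c x) - exp (- (c + h) x) <= 1 -
    exp (- h x) for x >= 0, and continuity at 0 expresses that L_k is finite. In the converse, exp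
    (- L_k / ell n) always has a limit law on [0, 1] once its moments converge; the danger is an
    atom at 0, that is, mass of L_k / ell n escaping to infinity. The hypothesis that G(c) tends to
    1 excludes exactly this. In (i) the law of G(c) is to be unique among all real random variables,
    so a competitor with the same moments must first be shown to be almost surely bounded. *)

Section tree_combinatorics.
Variable n : nat.
Implicit Types (t F : edges n) (x y a b v : 'I_n.+1).

Lemma adj_sym F : symmetric (adj F).
Proof. by move=> x y; rewrite /adj /= finset.setUC. Qed.

Lemma connect_adj_sym F x y : connect (adj F) x y = connect (adj F) y x.
Proof. exact: (sym_connect_sym (adj_sym F)). Qed.

Lemma connect_adj_subset F t x y :
  F \subset t -> connect (adj F) x y -> connect (adj t) x y.
Proof.
move=> /fintype.subsetP Ft; apply: connect_sub => a b ab; apply: connect1.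
exact: Ft.
Qed.

(** A walk may cross the edge xy several times, but the three outcomes are stable under prepending
    one step, so induction along the walk suffices. *)
Lemma connect_adjD1 F x y a b : connect (adj F) a b ->
  let F' := (F :\ [set x; y])%SET in
  [\/ connect (adj F') a b,
      connect (adj F') a x /\ connect (adj F') y b
    | connect (adj F') a y /\ connect (adj F') x b].
Proof.
move=> + F'; case/connectP=> p + ->; elim: p a => [a _|c p IH a] /=.
  by constructor 1; exact: connect0.
case/andP=> ac /IH{IH}.
have [acE|acN] := eqVneq [set a; c]%SET [set x; y]%SET; last first.
  have H : connect (adj F') a c.
    by apply: connect1; rewrite /adj /= in_setD1 acN.
  case=> [h|[h1 h2]|[h1 h2]].
  - by constructor 1; apply: connect_trans h.
  - by constructor 2; split=> //; apply: connect_trans h1.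
  - by constructor 3; split=> //; apply: connect_trans h1.
have : a \in [set x; y]%SET by rewrite -acE in_set2 eqxx.
have : c \in [set x; y]%SET by rewrite -acE in_set2 eqxx orbT.
have : x \in [set a; c]%SET by rewrite acE in_set2 eqxx.
have : y \in [set a; c]%SET by rewrite acE in_set2 eqxx orbT.
rewrite !in_set2 => hy hx /orP[] /eqP cE /orP[] /eqP aE; subst a c.
(* Loops are not excluded here: in the first and the last of the four cases a = c, which forces x =
   y. *)
- move: hy; rewrite orbb => /eqP yE; subst y.
  by case=> [h|[h1 h2]|[h1 h2]];
    [constructor 1|constructor 2; split|constructor 2; split].
- case=> [h|[h1 h2]|[h1 h2]].
  + by constructor 3; split=> //; exact: connect0.
  + by constructor 1.
  + by constructor 3; split=> //; exact: connect0.
- case=> [h|[h1 h2]|[h1 h2]].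
  + by constructor 2; split=> //; exact: connect0.
  + by constructor 2; split=> //; exact: connect0.
  + by constructor 1.
- move: hx; rewrite orbb => /eqP xE; subst x.
  by case=> [h|[h1 h2]|[h1 h2]];
    [constructor 1|constructor 2; split|constructor 2; split].
Qed.

(* An x-y path avoiding the edge xy would close to a cycle. *)
Lemma tree_edge_bridge t x y : is_tree t -> [set x; y]%SET \in t ->
  ~~ connect (adj (t :\ [set x; y])%SET) x y.
Proof.
case=> t2 _ tacy xyt; apply/negP => /connectP[p0 p0P yE].
move: yE; case/shortenP: p0P => p pP pU _ yE.
have xNy : x != y by have := t2 _ xyt; rewrite cards2; case: eqP.
have tp : path (adj t) x p.
  apply: sub_path pP => a b /=; rewrite /adj /= in_setD1 => /andP[_ ->] //.
have : (size (x :: p) <= 2)%N.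
  apply: tacy; rewrite /ucycle pU andbT /cycle rcons_path tp /=.
  by rewrite -yE /adj /= finset.setUC.
case: p pP yE {tp pU} => [|z [|//]] /=.
  by move=> _ yE; rewrite yE eqxx in xNy.
by move=> + yE; rewrite yE /adj /= in_setD1 eqxx.
Qed.

(** In a tree these are the edges of the path from the root to v; separation describes them without
    choosing a path. *)
Definition bridges t v : edges n :=
  [set e in t | ~~ connect (adj (t :\ e)%SET) ord0 v]%SET.

(** For the converse, take a smallest [F0] inside t joining the root to v. If an edge xy of [F0]
    were no bridge, the root and v would be joined in t without xy; by minimality [F0] uses xy, so
    its two remaining pieces would join x to y without xy, against [tree_edge_bridge]. Hence [F0]
    consists of bridges. *)
Lemma connect_bridges t F v : is_tree t -> F \subset t ->
  connect (adj F) ord0 v = (bridges t v \subset F).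
Proof.
move=> tT Ft; apply/idP/idP => [Fv|].
  apply/fintype.subsetP => e; rewrite inE => /andP[et]; apply: contraNT => eF.
  by apply: connect_adj_subset Fv; rewrite subsetD1 Ft.
move=> bF; apply: connect_adj_subset bF _.
have tv : connect (adj t) ord0 v by case: tT.
pose P (F : edges n) := (F \subset t) && connect (adj F) ord0 v.
have Pt : P t by rewrite /P fintype.subxx.
case: (arg_minnP (fun F : edges n => #|F|) Pt) => F0 /andP[F0t F0v] F0min.
apply: (@connect_adj_subset F0) => //; apply/fintype.subsetP => e eF0.
have et : e \in t by apply: (fintype.subsetP F0t).
rewrite inE et /=; apply/negP => tev.
have /eqP/cards2P[x [y [xy eE]]] : #|e| = 2%N by case: tT => t2 _ _; exact: t2.
have F0e : (F0 :\ e)%SET \subset (t :\ e)%SET by apply: finset.setSD.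
have : ~~ P (F0 :\ e)%SET.
  by apply/negP => /F0min; rewrite (cardsD1 e F0) eF0 ltnn.
rewrite /P (fintype.subset_trans (finset.subsetDl _ _) F0t) /= => F0Nv.
have := tree_edge_bridge tT; rewrite eE in et tev F0e F0Nv * => /(_ _ _ et).
have := connect_adjD1 x y F0v; move=> /= [h|[h1 h2]|[h1 h2]].
- by rewrite h in F0Nv.
- case/negP; apply: connect_trans (_ : connect _ ord0 y).
    by rewrite connect_adj_sym; exact: connect_adj_subset h1.
  apply: (connect_trans tev); rewrite connect_adj_sym.
  exact: connect_adj_subset h2.
- case/negP; apply: connect_trans (_ : connect _ v y).
    by apply: connect_adj_subset h2.
  apply: connect_trans (_ : connect _ ord0 y).
    by rewrite connect_adj_sym.
  exact: connect_adj_subset h1.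
Qed.

Lemma all_connect_bridges t F (s : seq 'I_n.+1) : is_tree t -> F \subset t ->
  all (connect (adj F) ord0) s = (\bigcup_(v <- s) bridges t v \subset F)%SET.
Proof.
move=> tT Ft; elim: s => [|v s IH]; first by rewrite big_nil finset.sub0set.
by rewrite /= big_cons finset.subUset IH (connect_bridges _ tT Ft).
Qed.

(** The candidates of the minimum are exactly the subsets of t that contain [S], and [S] is one of
    them. *)
Lemma reduced_lengthE t (s : seq 'I_n.+1) : is_tree t ->
  reduced_length t s = #|\bigcup_(v <- s) bridges t v|%SET.
Proof.
move=> tT; set S := (\bigcup_(v <- s) _)%SET.
have St : S \subset t.
  rewrite -(all_connect_bridges s tT (fintype.subxx t)).
  by apply/allP => v _; case: tT.
apply/eqP; rewrite eqn_leq; apply/andP; split.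
  rewrite /reduced_length -minEnat -leEnat; apply: bigmin_le_cond.
  by rewrite St (all_connect_bridges _ tT) // fintype.subxx.
(* The first case is the default value [#|t|] of the minimum. *)
rewrite /reduced_length; elim/big_ind: _ => [|a b ha hb|F /andP[Ft]].
- exact: subset_leq_card.
- by rewrite leq_min ha.
- by rewrite (all_connect_bridges _ tT) // => /subset_leq_card.
Qed.

End tree_combinatorics.

(** Expand the product of [f e + g e] over all edges: [f] vanishes off t and [g] on S, so only sets
    between S and t survive. The factor is p on S and 1 elsewhere, as p + (1 - p) = 1. *)
Lemma percolation_superset (R : comPzRingType) (E : finType) (t S : {set E})
    (p : R) : S \subset t ->
  \sum_(F : {set E} | (F \subset t) && (S \subset F))
     \prod_(e in t) (if e \in F then p else 1 - p) = p ^+ #|S|.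
Proof.
move=> St.
pose f e := if e \in t then p else 0 : R.
pose g e := if e \in t then (if e \in S then 0 else 1 - p) else 1 : R.
transitivity (\prod_e (f e + g e)); last first.
  transitivity (\prod_e (if e \in S then p else 1)).
    apply: eq_bigr => e _; rewrite /f /g; case: ifP => et.
      by case: ifP => eS; ring.
    case: ifP => eS; last by rewrite add0r.
    by rewrite (fintype.subsetP St) in et.
  by rewrite -big_mkcond /= prodr_const.
rewrite bigA_distr.
rewrite [RHS](bigID (fun F : {set E} => (F \subset t) && (S \subset F))) /=.
rewrite [X in _ = _ + X]big1 ?addr0; last first.
  move=> F; rewrite negb_and => /orP[] /subsetPn[e h1 h2];
    rewrite (bigD1 e) //=.
    by rewrite h1 /f (negbTE h2) mul0r.
  by rewrite (negbTE h2) /g h1 (fintype.subsetP St) // mul0r.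
apply: eq_bigr => F /andP[/fintype.subsetP Ft /fintype.subsetP SF].
rewrite big_mkcond /=; apply: eq_bigr => e _; rewrite /f /g.
case: (boolP (e \in F)) => eF; first by rewrite Ft.
case: ifP => // et; case: ifP => // /SF eF'.
by rewrite eF' in eF.
Qed.

(** * Weierstrass approximation *)

Section weierstrass.
Variable R : realType.
Implicit Types (f : R -> R) (g : nat -> R) (x : R).

(* [(bernstein N g).[x]] is the mean of g over the binomial law of parameters
   N and x, defined by conditioning on the first trial. *)
Fixpoint bernstein (N : nat) g : {poly R} :=
  if N is N'.+1 then
    'X * bernstein N' (fun i => g i.+1) + (1 - 'X) * bernstein N' g
  else (g 0%N)%:P.

Lemma bernsteinS N g x : (bernstein N.+1 g).[x] =
  x * (bernstein N (fun i => g i.+1)).[x] + (1 - x) * (bernstein N g).[x].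
Proof. by rewrite /= !hornerE. Qed.

Lemma le_bernstein N g h x : 0 <= x <= 1 ->
  (forall i, (i <= N)%N -> g i <= h i) ->
  (bernstein N g).[x] <= (bernstein N h).[x].
Proof.
move=> x01; elim: N g h => [|N IH] g h gh; first by rewrite !hornerC gh.
rewrite !bernsteinS lerD // ler_wpM2l //; try lra.
  by apply: IH => i iN; apply: gh.
by apply: IH => i iN; apply: gh; apply: leqW.
Qed.

(** The binomial law has mean N x and variance N x (1 - x). General quadratics are needed for the
    induction, since the shift of i turns one quadratic into another. *)
Lemma bernstein_quadratic N a b c x :
  (bernstein N (fun i => a * i%:R ^+ 2 + b * i%:R + c)).[x] =
  a * (N%:R * x * (1 - x) + (N%:R * x) ^+ 2) + b * (N%:R * x) + c.
Proof.
elim: N a b c => [|N IH] a b c; first by rewrite hornerC; ring.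
rewrite bernsteinS IH.
have -> : (fun i => a * i.+1%:R ^+ 2 + b * i.+1%:R + c) =
    (fun i => a * i%:R ^+ 2 + (a *+ 2 + b) * i%:R + (a + b + c)).
  by apply/funext => i; rewrite -natr1; ring.
by rewrite IH -natr1; ring.
Qed.

Lemma bernsteinD N g h x : (bernstein N (fun i => g i + h i)).[x] =
  (bernstein N g).[x] + (bernstein N h).[x].
Proof.
elim: N g h => [|N IH] g h; first by rewrite !hornerC.
by rewrite !bernsteinS !IH; ring.
Qed.

(** Compactness in its near-covering form: half a radius of continuity at x serves all points close
    to x. Only one of the two points is confined to the segment. *)
Lemma unif_continuous_segment f a b e : continuous f -> 0 < e ->
  exists2 d, 0 < d & forall x y, x \in `[a, b] ->
    `|x - y| < d -> `|f x - f y| < e.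
Proof.
move=> cf e0.
have e20 : 0 < e / 2 by rewrite divr_gt0.
pose P (d x : R) := forall y, `|x - y| < d -> `|f x - f y| < e.
have /compact_near_coveringP cK := @segment_compact R a b.
have /(_ _)[] := cK R (0^'+) P _.
  move=> x _.
  have := cf x => /cvgrPdist_lt/(_ _ e20)/nbhs_ballP[d /= d0 xd].
  exists (ball x (d / 2), [set d' | 0 < d' < d / 2]) => /=.
    split; first by apply: nbhsx_ballx; rewrite divr_gt0.
    by near=> d'; apply/andP; split; near: d';
      [exact: nbhs_right_gt|apply: nbhs_right_lt; rewrite divr_gt0].
  move=> [x' d'] /= [xx' /andP[d'0 d'd]] y x'y.
  have h1 : `|f x - f x'| < e / 2.
    by apply: xd; rewrite /ball /= in xx' *; lra.
  have h2 : `|f x - f y| < e / 2.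
    apply: xd; rewrite /ball /= in xx' *.
    by have := ler_distD x' x y; lra.
  by have := ler_distD (f x) (f x') (f y); rewrite (distrC (f x') (f x)); lra.
move=> d /= d0 H.
exists (d / 2); first by rewrite divr_gt0.
move=> x y xab; apply: (H (d / 2)) => //=.
  by rewrite sub0r normrN gtr0_norm ?divr_gt0 //; lra.
by rewrite divr_gt0.
Unshelve. all: by end_near. Qed.

Lemma continuous_bounded_segment f a b : continuous f ->
  exists2 M, 0 < M & forall x, x \in `[a, b] -> `|f x| <= M.
Proof.
move=> cf; have [d d0 H] := unif_continuous_segment a b cf ltr01.
have : compact (f @` `[a, b]%classic).
  apply: continuous_compact; last exact: segment_compact.
  by apply: continuous_subspaceT.
move=> /compact_bounded[M [_ HM]].
exists (Num.max 1 (M + 1)); first by rewrite lt_max ltr01.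
move=> x xab; apply: HM; last by exists x.
by rewrite lt_max ltrDl ltr01 orbT.
Qed.

(** Chebyshev's argument: |f x - f y| <= e / 2 + K (x - y) ^ 2 with K = 2 M / d ^ 2, by uniform
    continuity if |x - y| < d and by boundedness otherwise. At y = i / N the right-hand side is the
    quadratic [g] in i, whose binomial mean e / 2 + K x (1 - x) / N is at most e for large N. *)
Lemma bernstein_approx f e : continuous f -> 0 < e ->
  exists p : {poly R}, forall x, 0 <= x <= 1 -> `|f x - p.[x]| <= e.
Proof.
move=> cf e0.
have e20 : 0 < e / 2 by rewrite divr_gt0.
have [d d0 fd] := unif_continuous_segment 0 1 cf e20.
have [M M0 fM] := continuous_bounded_segment 0 1 cf.
pose K := 2 * M / d ^+ 2.
have K0 : 0 < K by rewrite divr_gt0 ?exprn_gt0 ?mulr_gt0.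
have [N [N0 NK]] : exists N, (0 < N)%N /\ K / N%:R <= e / 2.
  exists (Num.truncn (K / (e / 2))).+1; split => //.
  rewrite ler_pdivrMr ?ltr0n // mulrC -ler_pdivrMr //.
  by apply/ltW; rewrite truncnS_gt.
have N0' : 0 < N%:R :> R by rewrite ltr0n.
exists (bernstein N (fun i => f (i%:R / N%:R))) => x x01.
pose g i := K / N%:R ^+ 2 * i%:R ^+ 2 + (- (2 * K * x / N%:R)) * i%:R
  + (K * x ^+ 2 + e / 2).
have gE i : g i = e / 2 + K * (x - i%:R / N%:R) ^+ 2 by rewrite /g; field; lra.
have Bg : (bernstein N g).[x] <= e.
  rewrite bernstein_quadratic.
  rewrite [leLHS](_ : _ = K / N%:R * (x * (1 - x)) + e / 2); last first.
    by move: (K) => K'; field; lra.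
  have : K / N%:R * (x * (1 - x)) <= K / N%:R * 1.
    by rewrite ler_wpM2l ?divr_ge0 ?ltW //; nra.
  lra.
have fg i : (i <= N)%N -> `|f x - f (i%:R / N%:R)| <= g i.
  move=> iN; rewrite gE.
  have [xi|xi] := ltP `|x - i%:R / N%:R| d.
    apply: (@le_trans _ _ (e / 2)); first by apply/ltW/fd.
    by rewrite lerDl mulr_ge0 ?sqr_ge0 // ltW.
  have h1 : `|f x - f (i%:R / N%:R)| <= 2 * M.
    rewrite (le_trans (ler_normB _ _)) // mulrDl mul1r lerD // fM //.
    by rewrite in_itv /= divr_ge0 //= ler_pdivrMr // mul1r ler_nat.
  have : d ^+ 2 <= (x - i%:R / N%:R) ^+ 2.
    by rewrite -[leRHS]real_normK ?num_real // ler_pXn2r // nnegrE ltW.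
  rewrite -(ler_pM2l K0) {1}/K divfK; last by rewrite expf_neq0 // gt_eqF.
  lra.
have cst c : (bernstein N (fun=> c)).[x] = c.
  have := bernstein_quadratic N 0 0 c x.
  under [X in bernstein N X]eq_fun do rewrite !mul0r !add0r.
  by move=> ->; rewrite !mul0r !add0r.
rewrite ler_norml; apply/andP; split.
  have : (bernstein N (fun i => f (i%:R / N%:R))).[x] <=
      (bernstein N (fun i => f x + g i)).[x].
    by apply: le_bernstein => // i /fg; rewrite ler_norml; lra.
  by rewrite bernsteinD cst; lra.
have : (bernstein N (fun=> f x)).[x] <=
    (bernstein N (fun i => f (i%:R / N%:R) + g i)).[x].
  by apply: le_bernstein => // i /fg; rewrite ler_norml; lra.
by rewrite bernsteinD cst; lra.
Qed.

Theorem weierstrass f a b e : continuous f -> a < b -> 0 < e ->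
  exists p : {poly R}, forall x, a <= x <= b -> `|f x - p.[x]| <= e.
Proof.
move=> cf ab e0.
have cf' : continuous (fun t => f (a + (b - a) * t)).
  move=> t; apply: continuous_comp; last exact: cf.
  by apply: cvgD; [exact: cvg_cst|apply: cvgMr; exact: cvg_id].
have [p Hp] := bernstein_approx cf' e0.
exists (p \Po ((b - a)^-1 *: ('X - a%:P))) => x xab.
rewrite horner_comp !hornerE.
have := Hp ((b - a)^-1 * (x - a)).
have -> : a + (b - a) * ((b - a)^-1 * (x - a)) = x by field; lra.
apply.
by rewrite mulr_ge0 ?invr_ge0 /= ?ler_pdivrMl; lra.
Qed.
End weierstrass.

(** * Expectations of bounded random variables *)

Section bounded_expectation.
Context d (T : measurableType d) (R : realType) (P : probability T R).
Implicit Types (f g : T -> R).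

(** A real-valued expectation keeps the estimates within real arithmetic; [bounded_mfun] supplies
    the integrability that makes it meaningful. *)
Definition ev g : R := fine 'E_P[g].

Definition bounded_mfun g :=
  measurable_fun setT g /\ exists M, forall w, `|g w| <= M.

Lemma bounded_mfun_integrable g :
  bounded_mfun g -> P.-integrable setT (EFin \o g).
Proof.
move=> [mg [M gM]]; apply: measurable_bounded_integrable => //.
  by rewrite [X in (X < _)%E]probability_setT ltry.
exists M; split; first exact: num_real.
by move=> y My w _ /=; rewrite (le_trans (gM w)) // ltW.
Qed.

Lemma bounded_mfun_Lfun g : bounded_mfun g -> g \in Lfun P 1.
Proof. by move=> /bounded_mfun_integrable; move/Lfun1_integrable. Qed.

Lemma evE g : bounded_mfun g -> ('E_P[g] = (ev g)%:E)%E.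
Proof.
by move=> bg; rewrite /ev fineK // expectation_fin_num // bounded_mfun_Lfun.
Qed.

Lemma bounded_mfun_cst c : bounded_mfun (fun=> c).
Proof. by split; [exact: measurable_cst|exists `|c|]. Qed.

Lemma bounded_mfunD f g : bounded_mfun f -> bounded_mfun g ->
  bounded_mfun (fun w => f w + g w).
Proof.
move=> [mf [M fM]] [mg [N gN]]; split; first exact: measurable_funD.
by exists (M + N) => w; rewrite (le_trans (ler_normD _ _)) // lerD.
Qed.

Lemma bounded_mfunM f g : bounded_mfun f -> bounded_mfun g ->
  bounded_mfun (fun w => f w * g w).
Proof.
move=> [mf [M fM]] [mg [N gN]]; split; first exact: measurable_funM.
by exists (M * N) => w; rewrite normrM ler_pM.
Qed.

Lemma bounded_mfunB f g : bounded_mfun f -> bounded_mfun g ->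
  bounded_mfun (fun w => f w - g w).
Proof.
move=> bf bg; rewrite (_ : (fun _ => _) = fun w => f w + (-1) * g w).
  by apply: bounded_mfunD => //; apply: bounded_mfunM => //;
     exact: bounded_mfun_cst.
by apply/funext => w; rewrite mulN1r.
Qed.

Lemma bounded_mfunX g k : bounded_mfun g -> bounded_mfun (fun w => g w ^+ k).
Proof.
move=> bg; elim: k => [|k IH]; first exact: bounded_mfun_cst.
by under eq_fun do rewrite exprS; exact: bounded_mfunM.
Qed.

Lemma bounded_mfun_sum (I : Type) (r : seq I) (F : I -> T -> R) :
  (forall i, bounded_mfun (F i)) ->
  bounded_mfun (fun w => \sum_(i <- r) F i w).
Proof.
move=> bF; elim: r => [|i r IH].
  by under eq_fun do rewrite big_nil; exact: bounded_mfun_cst.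
by under eq_fun do rewrite big_cons; exact: bounded_mfunD.
Qed.

Lemma bounded_mfun_indic (A : set T) : measurable A ->
  bounded_mfun (\1_A : T -> R).
Proof.
move=> mA; split; first exact: measurable_indic.
by exists 1 => w; rewrite indicE; case: (_ \in _); rewrite ?normr1 ?normr0.
Qed.

Lemma ev_cst c : ev (fun=> c) = c.
Proof. by rewrite /ev expectation_cst. Qed.

Lemma evD f g : bounded_mfun f -> bounded_mfun g ->
  ev (fun w => f w + g w) = ev f + ev g.
Proof.
move=> bf bg; rewrite {1}/ev (_ : (fun _ => _) = f \+ g) //.
by rewrite expectationD ?bounded_mfun_Lfun // !evE.
Qed.

Lemma evZ c g : bounded_mfun g -> ev (fun w => c * g w) = c * ev g.
Proof.
move=> bg; rewrite {1}/ev (_ : (fun _ => _) = c \o* g).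
  by rewrite expectationZl ?bounded_mfun_Lfun // evE.
by apply/funext => w /=; rewrite mulrC.
Qed.

Lemma evB f g : bounded_mfun f -> bounded_mfun g ->
  ev (fun w => f w - g w) = ev f - ev g.
Proof.
move=> bf bg; rewrite {1}/ev (_ : (fun _ => _) = f \- g) //.
by rewrite expectationB ?bounded_mfun_Lfun // !evE.
Qed.

Lemma ev_sum (I : Type) (r : seq I) (F : I -> T -> R) :
  (forall i, bounded_mfun (F i)) ->
  ev (fun w => \sum_(i <- r) F i w) = \sum_(i <- r) ev (F i).
Proof.
move=> bF; elim: r => [|i r IH].
  by under eq_fun do rewrite big_nil; rewrite big_nil ev_cst.
under eq_fun do rewrite big_cons; rewrite big_cons evD ?IH //.
exact: bounded_mfun_sum.
Qed.

Lemma ev_ge0 g : (forall w, 0 <= g w) -> 0 <= ev g.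
Proof. by move=> g0; rewrite fine_ge0 // expectation_ge0. Qed.

Lemma ev_le f g : bounded_mfun f -> bounded_mfun g ->
  (forall w, f w <= g w) -> ev f <= ev g.
Proof.
move=> bf bg fg; rewrite -subr_ge0 -evB //.
by apply: ev_ge0 => w; rewrite subr_ge0.
Qed.

Lemma ev_dist_le f g h : bounded_mfun f -> bounded_mfun g -> bounded_mfun h ->
  (forall w, `|f w - g w| <= h w) -> `|ev f - ev g| <= ev h.
Proof.
move=> bf bg bh fgh; rewrite ler_norml; apply/andP; split.
  rewrite lerBrDr addrC -evB //; apply: ev_le => //.
    exact: bounded_mfunB.
  by move=> w; have := fgh w; rewrite ler_norml; lra.
rewrite lerBlDr addrC -evD //; apply: ev_le => //; first exact: bounded_mfunD.
by move=> w; have := fgh w; rewrite ler_norml; lra.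
Qed.

Lemma ev_dist_le_cst f g e : bounded_mfun f -> bounded_mfun g ->
  (forall w, `|f w - g w| <= e) -> `|ev f - ev g| <= e.
Proof.
by move=> bf bg fg; rewrite -[leRHS]ev_cst; apply: ev_dist_le => //;
  exact: bounded_mfun_cst.
Qed.

Lemma ev_indic (A : set T) : measurable A -> (ev (\1_A))%:E = P A.
Proof.
by move=> mA; rewrite -evE ?expectation_indic //; exact: bounded_mfun_indic.
Qed.

Lemma bounded_mfun_comp (h : R -> R) g : continuous h -> bounded_mfun g ->
  bounded_mfun (fun w => h (g w)).
Proof.
move=> ch [mg [M gM]]; split.
  apply: (measurableT_comp _ mg); exact: continuous_measurable_fun.
have [N _ hN] := continuous_bounded_segment (- M) M ch.
by exists N => w; apply: hN; rewrite in_itv /= -ler_norml.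
Qed.

End bounded_expectation.

(** * Expectations controlled by moments *)

Section randvar_expectation.
Variable R : realType.
Implicit Types (X Y : randvar R) (f : R -> R) (p : {poly R}).

Definition rv_ev X f : R := ev (rv_prob X) (fun w => f (X w)).

Definition rv_within a b X := forall w, a <= X w <= b.

Lemma rv_within_bounded a b X : rv_within a b X -> bounded_mfun X.
Proof.
move=> Xab; split => //; exists (`|a| + `|b|) => w.
rewrite ler_norml; have := Xab w; have := ler_norm b; have := ler_norm (- a).
by rewrite normrN; have := normr_ge0 a; have := normr_ge0 b; lra.
Qed.

Lemma rv_within_continuous a b X f : rv_within a b X -> continuous f ->
  bounded_mfun (fun w => f (X w)).
Proof. by move=> /rv_within_bounded bX cf; exact: bounded_mfun_comp. Qed.

Lemma bounded_mfun_rv X f : continuous f -> bounded_fun f ->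
  bounded_mfun (fun w => f (X w)).
Proof.
move=> cf [M [_ fM]]; split.
  by apply: measurableT_comp => //; exact: continuous_measurable_fun.
by exists (M + 1) => w; apply: fM => //; rewrite ltrDl.
Qed.

Lemma measurable_dist_gt X (a e : R) :
  measurable [set w | e < `|X w - a|].
Proof.
have mf : measurable_fun setT (fun w => `|X w - a|).
  apply: measurableT_comp; first exact: normr_measurable.
  by apply: measurable_funB.
rewrite (_ : [set w | _] =
    setT `&` (fun w => `|X w - a|) @^-1` `]e, +oo[%classic); first exact: mf.
by rewrite setTI; apply/seteqP; split=> w; rewrite /= in_itv /= andbT.
Qed.

Lemma rv_expectE X f : bounded_mfun (fun w => f (X w)) ->
  rv_expect X f = (rv_ev X f)%:E.
Proof. exact: evE. Qed.

Lemma rv_ev_horner X p : bounded_mfun X ->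
  rv_ev X (horner p) = \sum_(i < size p) p`_i * rv_ev X (fun x => x ^+ i).
Proof.
move=> bX; rewrite /rv_ev; under eq_fun do rewrite horner_coef.
rewrite ev_sum => [|i]; last first.
  by apply: bounded_mfunM; [exact: bounded_mfun_cst|exact: bounded_mfunX].
by apply: eq_bigr => i _; rewrite evZ //; exact: bounded_mfunX.
Qed.

(** The polynomial is chosen before X, so it serves a whole sequence and its limit at once. *)
Lemma rv_ev_poly_approx a b f e : continuous f -> a < b -> 0 < e ->
  exists p, forall X, rv_within a b X -> `|rv_ev X f -
    \sum_(i < size p) p`_i * rv_ev X (fun x => x ^+ i)| <= e.
Proof.
move=> cf ab e0; have [p pf] := weierstrass cf ab e0.
exists p => X Xab; rewrite -rv_ev_horner; last exact: rv_within_bounded Xab.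
apply: ev_dist_le_cst => [||w].
- exact: rv_within_continuous Xab _.
- by apply: rv_within_continuous Xab _; exact: continuous_horner.
- exact/pf/Xab.
Qed.

Lemma cvg_sumr (I : Type) (r : seq I) (u : I -> nat -> R) (l : I -> R) :
  (forall i, u i n @[n --> \oo] --> l i) ->
  \sum_(i <- r) u i n @[n --> \oo] --> \sum_(i <- r) l i.
Proof.
move=> ul; elim: r => [|i r IH].
  by under eq_fun do rewrite big_nil; rewrite big_nil; exact: cvg_cst.
by under eq_fun do rewrite big_cons; rewrite big_cons; exact: cvgD.
Qed.

(** No limit law is known at this stage, so the limit comes from completeness: the expectations are
    eventually within e of the number [S] built from the limit moments. *)
Lemma cvg_moments_cvg (X : nat -> randvar R) a b f : continuous f -> a < b ->
  (forall n, rv_within a b (X n)) ->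
  (forall k, cvgn (fun n => rv_ev (X n) (fun x => x ^+ k))) ->
  cvgn (fun n => rv_ev (X n) f).
Proof.
move=> cf ab Xab cX; apply/cauchy_cvgP/cauchy_exP => e e0.
have e20 : 0 < e / 2 by rewrite divr_gt0.
have [p Hp] := rv_ev_poly_approx cf ab e20.
pose s n := \sum_(i < size p) p`_i * rv_ev (X n) (fun x => x ^+ i).
pose S := \sum_(i < size p) p`_i *
  limn (fun n => rv_ev (X n) (fun x => x ^+ i)).
have cs : s n @[n --> \oo] --> S.
  by apply: cvg_sumr => i; apply: cvgMr; exact: cX.
exists S; move: cs => /cvgrPdist_lt/(_ _ e20); apply: filterS => n /=.
rewrite /ball /=; have := Hp _ (Xab n); rewrite -/(s n).
by rewrite ler_norml !ltr_norml; lra.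
Qed.

Lemma moments_cvg_ev (X : nat -> randvar R) Y a b f : continuous f -> a < b ->
  (forall n, rv_within a b (X n)) -> rv_within a b Y ->
  (forall k, (0 < k)%N -> rv_ev (X n) (fun x => x ^+ k) @[n --> \oo] -->
    rv_ev Y (fun x => x ^+ k)) ->
  rv_ev (X n) f @[n --> \oo] --> rv_ev Y f.
Proof.
move=> cf ab Xab Yab cX; apply/cvgrPdist_le => e e0.
have e30 : 0 < e / 3 by rewrite divr_gt0.
have [p Hp] := rv_ev_poly_approx cf ab e30.
pose s X := \sum_(i < size p) p`_i * rv_ev X (fun x => x ^+ i).
have cs : s (X n) @[n --> \oo] --> s Y.
  apply: cvg_sumr => i; apply: cvgMr.
  have [i0|/cX//] := posnP i.
  have ev1 Z : rv_ev Z (fun x => x ^+ 0) = 1 by exact: (ev_cst _ 1).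
  by rewrite i0 ev1; under eq_fun do rewrite ev1; exact: cvg_cst.
move: cs => /cvgrPdist_le/(_ _ e30); apply: filterS => n.
have := Hp _ Yab; have := Hp _ (Xab n); rewrite -!/(s _).
by rewrite !ler_norml; lra.
Qed.
End randvar_expectation.

(** * The moment problem on [0, 1] *)

Section clip.
Variable R : realType.
Implicit Types x y h : R.

Definition clip01 x : R := Num.min 1 (Num.max 0 x).

Lemma clip01P x : [\/ x <= 0 /\ clip01 x = 0, 0 <= x <= 1 /\ clip01 x = x
  | 1 <= x /\ clip01 x = 1].
Proof.
rewrite /clip01; case: (leP 0 x) => x0; last first.
  by constructor 1; rewrite ltW // min_r.
by case: (leP 1 x) => x1; [constructor 3|constructor 2; split; lra].
Qed.

Lemma clip01_itv x : 0 <= clip01 x <= 1.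
Proof. by case: (clip01P x) => -[]; lra. Qed.

Lemma clip01_id x : 0 <= x <= 1 -> clip01 x = x.
Proof. by case: (clip01P x) => -[]; lra. Qed.

Lemma clip01_le0 x : x <= 0 -> clip01 x = 0.
Proof. by case: (clip01P x) => -[]; lra. Qed.

Lemma clip01_ge1 x : 1 <= x -> clip01 x = 1.
Proof. by case: (clip01P x) => -[]; lra. Qed.

Lemma le_clip01 x y : x <= y -> clip01 x <= clip01 y.
Proof. by case: (clip01P x) => -[]; case: (clip01P y) => -[]; lra. Qed.

Lemma clip01D x y : 0 <= y -> clip01 (x + y) <= clip01 x + y.
Proof. by case: (clip01P x) => -[]; case: (clip01P (x + y)) => -[]; lra. Qed.

Lemma continuous_clip01 : continuous clip01.
Proof.
move=> x; apply: continuous_min; first exact: cvg_cst.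
by apply: continuous_max; [exact: cvg_cst|exact: cvg_id].
Qed.

(** A continuous upper approximation of the indicator of y <= x, falling linearly from 1 to 0
    between x and x + h. *)
Definition ramp x h y : R := clip01 ((x + h - y) / h).

Lemma continuous_ramp x h : continuous (ramp x h).
Proof.
move=> y; apply: (@continuous_comp _ _ _ (fun y => (x + h - y) / h) clip01).
  2: exact: continuous_clip01.
by apply: cvgMl; apply: cvgB; [exact: cvg_cst|exact: cvg_id].
Qed.

Lemma ramp_itv x h y : 0 <= ramp x h y <= 1.
Proof. exact: clip01_itv. Qed.

Lemma ramp_eq1 x h y : 0 < h -> y <= x -> ramp x h y = 1.
Proof. by move=> h0 yx; rewrite /ramp clip01_ge1 // ler_pdivlMr //; lra. Qed.

Lemma ramp_eq0 x h y : 0 < h -> x + h <= y -> ramp x h y = 0.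
Proof.
move=> h0 yx; rewrite /ramp clip01_le0 // ler_pdivrMr //; lra.
Qed.

End clip.

Section helly.
Variable R : realType.
Implicit Types (X : randvar R) (x h : R).

(** The variable on the Stieltjes space of F is [clip01], not the identity, so that it lies in
    [0, 1] at every point. For 0 <= r < 1 the event is the same, and for other r both sides are 0 or
    1. *)
Lemma randvar_of_cdf (F : R -> R) : {homo F : x y / x <= y} ->
  (forall x, F y @[y --> x^'+] --> F x) ->
  (forall x, x < 0 -> F x = 0) -> (forall x, 1 <= x -> F x = 1) ->
  exists X, rv_within 0 1 X /\
    forall r, rv_prob X [set w | X w <= r] = (F r)%:E.
Proof.
move=> Fnd Frc F0 F1.
have FNy : F @ -oo --> (0 : R).
  apply: (@cvg_trans _ (cst 0 @ -oo%R)); last exact: cvg_cst.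
  apply: near_eq_cvg.
  by apply: filterS (nbhs_ninfty_lt (num_real 0)) => x x0; rewrite /cst F0.
have Fy : F @ +oo --> (1 : R).
  apply: (@cvg_trans _ (cst 1 @ +oo%R)); last exact: cvg_cst.
  apply: near_eq_cvg.
  by apply: filterS (nbhs_pinfty_ge (num_real 1)) => x x1; rewrite /cst F1.
pose Fc : cumulativeBounded (0 : R) (1 : R) := HB.pack F
  (isCumulative.Build R _ R F Fnd Frc)
  (isCumulativeBounded.Build R 0 1 F FNy Fy).
pose g : measurableTypeR R -> R := @clip01 R.
have mg : measurable_fun setT g.
  by apply: continuous_measurable_fun; exact: continuous_clip01.
pose gm : {mfun measurableTypeR R >-> R} := HB.pack g
  (isMeasurableFun.Build _ _ _ _ g mg).
exists (@RandVar R _ _ (lebesgue_stieltjes_measure Fc) gm).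
split=> [w|r]; first exact: clip01_itv.
have [r0|r0] := ltP r 0.
  rewrite F0 // (_ : [set w | _] = set0) ?measure0 // -subset0 => w /=.
  by have := clip01_itv w; rewrite /g; lra.
have [r1|r1] := leP 1 r.
  rewrite F1 // (_ : [set w | _] = setT) ?probability_setT // -subTset.
  by move=> w _ /=; have := clip01_itv w; rewrite /g; lra.
rewrite -[RHS](cdf_lebesgue_stieltjes_id Fc r) /cdf /distribution /pushforward.
congr (lebesgue_stieltjes_measure _ _); apply/seteqP; split=> w;
  by rewrite /= /g in_itv /=; case: (clip01P w) => -[]; lra.
Qed.

End helly.

Section helly_moments.
Variable R : realType.
Implicit Types (Y : randvar R) (f : R -> R) (x h e : R).

(** By telescoping, indices below i contribute g i - g 0, those above i nothing, and i itself at
    most one increment. Complements of ramps and indicators of half-lines are both weights of this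
    kind. *)
Lemma staircase_sum (g w : nat -> R) (i N : nat) :
  {homo g : j k / (j <= k)%N >-> j <= k} -> (forall j, 0 <= w j <= 1) ->
  (forall j, (j < i)%N -> w j = 1) -> (forall j, (i < j)%N -> w j = 0) ->
  (i <= N)%N ->
  g i - g 0%N <= \sum_(0 <= j < N.+1) (g j.+1 - g j) * w j <= g i.+1 - g 0%N.
Proof.
move=> gnd w01 w1 w0 iN.
have a0 j : 0 <= g j.+1 - g j by rewrite subr_ge0; exact: gnd.
have term_ge0 j : 0 <= (g j.+1 - g j) * w j.
  by rewrite mulr_ge0 //; case/andP: (w01 j).
apply/andP; split.
  rewrite -(telescope_sumr g (leq0n i)).
  rewrite [leRHS](@big_cat_nat _ _ _ i) ?(leqW iN) //=.
  rewrite -[leLHS]addr0 lerD ?sumr_ge0 //.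
  rewrite big_nat_cond [leRHS]big_nat_cond.
  by apply: ler_sum => j /andP[/andP[_ ji] _]; rewrite w1 // mulr1.
rewrite -(telescope_sumr g (leq0n i.+1)) [leLHS](@big_cat_nat _ _ _ i.+1) //=.
rewrite [X in _ + X]big_nat_cond [X in _ + X]big1 ?addr0; last first.
  by move=> j /andP[/andP[ij _] _]; rewrite w0 // mulr0.
apply: ler_sum => j _; rewrite ler_piMr //.
by case/andP: (w01 j).
Qed.

(* Helly: F(x) = inf_h Lambda(ramp x h) is the distribution function of the
   limit, where Lambda f is the limit of E f(X_n); it is compared with Lambda
   on staircase approximations of f. *)
Lemma moment_limit (X : nat -> randvar R) : (forall n, rv_within 0 1 (X n)) ->
  (forall k, cvgn (fun n => rv_ev (X n) (fun x => x ^+ k))) ->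
  exists Y, rv_within 0 1 Y /\
    forall k, rv_ev (X n) (fun x => x ^+ k) @[n --> \oo] -->
      rv_ev Y (fun x => x ^+ k).
Proof.
move=> X01 cX; pose L f := limn (fun n => rv_ev (X n) f).
have bX n f : continuous f -> bounded_mfun (fun w => f (X n w)).
  exact: rv_within_continuous (X01 n).
have cL f : continuous f -> rv_ev (X n) f @[n --> \oo] --> L f.
  by move=> cf; apply: cvg_moments_cvg (X01) _ => //; exact: ltr01.
(* The slack c lets the same fact give monotonicity, right continuity of [F] and the error of the
   staircases. *)
have leL f f' c : continuous f -> continuous f' ->
    (forall x, 0 <= x <= 1 -> f x <= f' x + c) -> L f <= L f' + c.
  move=> cf cf' ff'; apply: (ler_cvg_to (cL _ cf)).
    by apply: cvgD (cL _ cf') _; exact: cvg_cst.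
  apply: nearW => n; rewrite -[leRHS]/(rv_ev (X n) f' + c) /rv_ev.
  rewrite -[X in _ <= _ + X](ev_cst (rv_prob (X n)) c).
  rewrite -evD //; [|exact: bX|exact: bounded_mfun_cst].
  apply: ev_le => [||w]; [exact: bX| |exact/ff'/X01].
  by apply: bounded_mfunD; [exact: bX|exact: bounded_mfun_cst].
have L_cst c : L (fun=> c) = c.
  apply: cvg_lim => //.
  by rewrite /rv_ev; under eq_fun do rewrite ev_cst; exact: cvg_cst.
have c_cst (c : R) : continuous (fun _ : R => c) by move=> ?; exact: cvg_cst.
have cr x h : continuous (ramp x h) by exact: continuous_ramp.
have L_ge0 x h : 0 <= L (ramp x h).
  rewrite -(L_cst 0) -[leRHS]addr0; apply: leL => // y _.
  by rewrite addr0; case/andP: (ramp_itv x h y).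
have L_le1 x h : L (ramp x h) <= 1.
  rewrite -(L_cst 1) -[leRHS]addr0; apply: leL => // y _.
  by rewrite addr0; case/andP: (ramp_itv x h y).
pose S x := [set L (ramp x h) | h in [set h : R | 0 < h]].
pose F x := inf (S x).
have S_inf x : has_inf (S x).
  split; first by exists (L (ramp x 1)), 1 => //=.
  by exists 0 => _ [h _ <-].
have F_le x h : 0 < h -> F x <= L (ramp x h).
  by move=> h0; apply: ge_inf; [case: (S_inf x)|exists h].
have F_glb x c : (forall h, 0 < h -> c <= L (ramp x h)) -> c <= F x.
  move=> cl; apply: lb_le_inf; first by case: (S_inf x).
  by move=> _ [h h0 <-]; exact: cl.
(* [ramp x h] vanishes beyond x + h, and every ramp at x + h equals 1 up to that point. *)
have L_leF x h : 0 < h -> L (ramp x h) <= F (x + h).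
  move=> h0; apply: F_glb => h' h'0; rewrite -[leRHS]addr0.
  apply: leL => // y _; rewrite addr0; have [yx|xy] := leP y (x + h).
    by rewrite [leRHS]ramp_eq1 //; case/andP: (ramp_itv x h y).
  by rewrite (ramp_eq0 h0 (ltW xy)); case/andP: (ramp_itv (x + h) h' y).
have F_nd : {homo F : x y / x <= y}.
  move=> x y; rewrite le_eqVlt => /predU1P[->//|xy].
  have h0 : 0 < y - x by rewrite subr_gt0.
  apply: (le_trans (F_le x _ h0)); apply: (le_trans (L_leF x _ h0)).
  by rewrite addrC subrK.
have F_rc x : F y @[y --> x^'+] --> F x.
  apply/cvgrPdist_le => e e0.
  have e20 : 0 < e / 2 by rewrite divr_gt0.
  (* With h nearly optimal for [F x], moving the ramp from x to y raises it by at most (y - x) / h,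
     hence the requirement y - x <= e / 2 * h. *)
  have [_ [h /= h0 <-] Lh] := inf_adherent e20 (S_inf x).
  near=> y.
  have xy : x < y by near: y; exact: nbhs_right_gt.
  have yh : y - x <= e / 2 * h.
    rewrite lerBlDl; near: y; apply: nbhs_right_le.
    by rewrite ltrDl mulr_gt0.
  rewrite distrC ger0_norm ?subr_ge0 ?F_nd ?ltW //.
  have : L (ramp y h) <= L (ramp x h) + e / 2.
    apply: leL => // z _; rewrite /ramp.
    rewrite (_ : (y + h - z) / h = (x + h - z) / h + (y - x) / h); last first.
      by field; lra.
    apply: (le_trans (clip01D _ _)); first by rewrite divr_ge0; lra.
    by rewrite lerD2l ler_pdivrMr.
  by have := F_le y h h0; rewrite -/(F x) in Lh *; lra.
have F0 x : x < 0 -> F x = 0.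
  move=> x0; apply/eqP; rewrite eq_le F_glb ?andbT //.
  have h0 : 0 < - x by rewrite oppr_gt0.
  apply: (le_trans (F_le x _ h0)); rewrite -(L_cst 0) -[leRHS]addr0.
  by apply: leL => // y y01; rewrite addr0 ramp_eq0 //; lra.
have F_le1 x : F x <= 1 by apply: le_trans (F_le x 1 _) (L_le1 _ _).
have F1 x : 1 <= x -> F x = 1.
  move=> x1; apply/eqP; rewrite eq_le F_le1 /=; apply: F_glb => h h0.
  rewrite -(L_cst 1) -[leRHS]addr0.
  by apply: leL => // y y01; rewrite addr0 ramp_eq1 //; lra.
have [Y [Y01 YF]] := randvar_of_cdf F_nd F_rc F0 F1.
exists Y; split => // k.
(* Clipping makes the power monotone on the whole line without changing it on [0, 1]. *)
pose f x : R := clip01 x ^+ k.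
have fE Z : rv_within 0 1 Z -> rv_ev Z (fun x => x ^+ k) = rv_ev Z f.
  move=> Z01; rewrite /rv_ev; congr (ev _ _).
  by apply/funext => w; rewrite /f clip01_id.
rewrite (fE _ Y01); under eq_fun do rewrite fE //.
have cf : continuous f.
  move=> x; apply: (@continuous_comp _ _ _ (@clip01 R) (fun x : R => x ^+ k)).
    exact: continuous_clip01.
  exact: exprn_continuous.
have f_nd : {homo f : x y / x <= y}.
  move=> x y xy; apply: lerXn2r; rewrite ?nnegrE ?le_clip01 //.
    by case/andP: (clip01_itv x).
  by case/andP: (clip01_itv y).
suff -> : rv_ev Y f = L f by exact: cL.
suff LfY e : 0 < e -> `|rv_ev Y f - L f| <= e.
  apply/eqP; rewrite -subr_eq0 -normr_le0; apply/ler_addgt0Pl => e e0.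
  by rewrite addr0; exact: LfY.
(* One third each for f against a staircase of ramps under [L], f against a staircase of indicators
   under Y, and the two staircases against each other. *)
move=> e30; rewrite (_ : e = 3 * (e / 3)); last by lra.
have : 0 < e / 3 by lra.
move: (e / 3) => {e30}e e0.
have [d d0 fd] := unif_continuous_segment 0 2 cf e0.
have [N [N0 Nd]] : exists N, (0 < N)%N /\ N%:R^-1 < d.
  exists (Num.truncn d^-1).+1; split => //.
  by rewrite -[ltRHS]invrK ltf_pV2 ?posrE ?invr_gt0 // truncnS_gt.
have N0' : 0 < N%:R :> R by rewrite ltr0n.
pose q (j : nat) : R := j%:R / N%:R.
have qS j : q j.+1 = q j + N%:R^-1 by rewrite /q -natr1 mulrDl mul1r.
have q_nd : {homo q : j l / (j <= l)%N >-> j <= l}.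
  by move=> j l jl; rewrite ler_pM2r ?invr_gt0 // ler_nat.
pose g j := f (q j); pose a j := g j.+1 - g j.
have g_nd : {homo g : j l / (j <= l)%N >-> j <= l}.
  by move=> j l /q_nd; exact: f_nd.
have a0 j : 0 <= a j by rewrite subr_ge0 g_nd.
have ae j : (j <= N)%N -> a j <= e.
  move=> jN; apply: (le_trans (ler_norm _)); apply/ltW; rewrite distrC.
  apply: fd; last by rewrite qS opprD addNKr normrN gtr0_norm ?invr_gt0.
  rewrite in_itv /= divr_ge0 //= ler_pdivrMr //.
  by apply: (@le_trans _ _ N%:R); rewrite ?ler_nat //; lra.
have stair (w : nat -> R -> R) y : 0 <= y <= 1 ->
    (forall j, 0 <= w j y <= 1) -> (forall j, q j.+1 <= y -> w j y = 1) ->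
    (forall j, y < q j -> w j y = 0) ->
    `|\sum_(0 <= j < N.+1) a j * w j y - (f y - g 0%N)| <= e.
  move=> y01 w01 w1 w0.
  have yN0 : 0 <= y * N%:R by rewrite mulr_ge0 //; lra.
  (* i is the grid cell of y; y = 1 falls into cell N, which is why the sums include the index N. *)
  have /andP[iy yi] := truncn_itv yN0; move: (Num.truncn _) iy yi => i iy yi.
  have {}iy : q i <= y by rewrite ler_pdivrMr.
  have {}yi : y < q i.+1 by rewrite ltr_pdivlMr.
  have iN : (i <= N)%N.
    by move: iy; rewrite ler_pdivrMr // -(ler_nat R); nra.
  have := staircase_sum g_nd w01 (i := i) (N := N) _ _ iN.
  rewrite -/a => /(_ _ _)/andP[].
  - by move=> j ji; apply: w1; apply: le_trans iy; exact: q_nd.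
  - by move=> j ij; apply: w0; apply: lt_le_trans yi _; exact: q_nd.
  - have := f_nd _ _ iy; have := f_nd _ _ (ltW yi); have := ae _ iN.
    by rewrite /a /g ler_norml; lra.
pose r j := ramp (q j) N%:R^-1.
have Nv0 : 0 < N%:R^-1 :> R by rewrite invr_gt0.
have stepL : `|\sum_(0 <= j < N.+1) a j * (1 - L (r j)) - (L f - g 0%N)| <= e.
  pose s y := \sum_(0 <= j < N.+1) a j * (1 - r j y).
  have cs : continuous s.
    move=> y; apply: cvg_big => //.
      exact: add_continuous.
    by move=> j _; apply: cvgMr; apply: cvgB; [exact: cvg_cst|exact: cr].
  have -> : \sum_(0 <= j < N.+1) a j * (1 - L (r j)) = L s.
    apply/esym/cvg_lim => //.
    have -> : (fun n => rv_ev (X n) s) =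
        (fun n => \sum_(0 <= j < N.+1) a j * (1 - rv_ev (X n) (r j))).
      apply/funext => n; rewrite /rv_ev ev_sum => [|j].
        apply: eq_bigr => j _; rewrite evZ; last first.
          apply: bounded_mfunB; [exact: bounded_mfun_cst|exact/bX/cr].
        by rewrite evB ?ev_cst //; [exact: bounded_mfun_cst|exact/bX/cr].
      apply: bounded_mfunM; first exact: bounded_mfun_cst.
      by apply: bounded_mfunB; [exact: bounded_mfun_cst|exact/bX/cr].
    apply: cvg_sumr => j; apply: cvgMr.
    by apply: cvgB; [exact: cvg_cst|exact/cL/cr].
  have sf y : 0 <= y <= 1 -> `|s y - (f y - g 0%N)| <= e.
    move=> y01; apply: (stair (fun j y => 1 - r j y)) => // j.
    - by have := ramp_itv (q j) N%:R^-1 y; rewrite /r; lra.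
    - by move=> qy; rewrite /r ramp_eq0 ?subr0 // -qS.
    - by move=> qy; rewrite /r ramp_eq1 ?subrr // ltW.
  have h1 : L s <= L f + (e - g 0%N).
    by apply: leL => // y /sf; rewrite ler_norml; lra.
  have h2 : L f <= L s + (e + g 0%N).
    by apply: leL => // y /sf; rewrite ler_norml; lra.
  by rewrite ler_norml; lra.
have stepY : `|\sum_(0 <= j < N.+1) a j * (1 - F (q j)) -
    (rv_ev Y f - g 0%N)| <= e.
  have mY c : measurable [set w | Y w <= c].
    rewrite (_ : [set w | _] = Y @^-1` `]-oo, c]%classic).
      exact: measurable_funPTI.
    by apply/seteqP; split=> w /=; rewrite in_itv.
  pose chi (j : nat) w : R := 1 - \1_[set w | Y w <= q j] w.
  have bchi j : bounded_mfun (chi j).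
    apply: bounded_mfunB; first exact: bounded_mfun_cst.
    exact: bounded_mfun_indic.
  have bYf : bounded_mfun (fun w => f (Y w)).
    exact: rv_within_continuous Y01 _.
  have chiE j : ev (rv_prob Y) (chi j) = 1 - F (q j).
    rewrite evB ?ev_cst //; last 2 first.
      exact: bounded_mfun_cst.
      exact: bounded_mfun_indic.
    by congr (_ - _); apply: EFin_inj; rewrite ev_indic // YF.
  have <- : ev (rv_prob Y) (fun w => \sum_(0 <= j < N.+1) a j * chi j w) =
      \sum_(0 <= j < N.+1) a j * (1 - F (q j)).
    rewrite ev_sum => [|j]; last first.
      by apply: bounded_mfunM; first exact: bounded_mfun_cst.
    by apply: eq_bigr => j _; rewrite evZ // chiE.
  rewrite /rv_ev -[g 0%N in X in _ - X](ev_cst (rv_prob Y) (g 0%N)) -evB //.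
    2: exact: bounded_mfun_cst.
  apply: ev_dist_le_cst => [||w].
  - apply: bounded_mfun_sum => j.
    by apply: bounded_mfunM; first exact: bounded_mfun_cst.
  - by apply: bounded_mfunB; last exact: bounded_mfun_cst.
  - have := stair (fun j y => (q j < y)%R%:R) (Y w) (Y01 w) => /= H.
    rewrite (eq_bigr (fun j => a j * (q j < Y w)%R%:R)); last first.
      move=> j _; rewrite /chi indicE ltNge; congr (_ * _).
      case: (boolP (Y w <= q j)) => h.
        by rewrite mem_set //= subrr.
      by rewrite memNset ?subr0 //; apply/negP.
    apply: H => j.
    + by case: (_ < _); rewrite ?lexx ?ler01.
    + by rewrite qS => qy; rewrite (lt_le_trans _ qy) // ltrDl.
    + by move=> yq; rewrite ltNge ltW.
have stepF : `|\sum_(0 <= j < N.+1) a j * (1 - L (r j)) -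
    \sum_(0 <= j < N.+1) a j * (1 - F (q j))| <= e.
  rewrite distrC -sumrB ger0_norm; last first.
    apply: sumr_ge0 => j _; rewrite -mulrBr mulr_ge0 //.
    by have := F_le (q j) _ Nv0; rewrite -/(r j); lra.
  (* [L (r j)] lies between [F (q j)] and [F (q j.+1)], and the increments of [F] telescope to at
     most 1. *)
  apply: (@le_trans _ _ (\sum_(0 <= j < N.+1) e * (F (q j.+1) - F (q j)))).
    rewrite big_nat_cond [leRHS]big_nat_cond.
    apply: ler_sum => j /andP[/andP[_ jN] _].
    have := F_le (q j) _ Nv0; have := L_leF (q j) _ Nv0.
    rewrite -/(r j) -qS; have := ae _ jN; have := a0 j; move: (a j) => aj.
    by nra.
  rewrite -mulr_sumr telescope_sumr //.
  have : 0 <= F (q 0%N) by apply: F_glb.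
  by have := F_le1 (q N.+1); nra.
by move: stepL stepY stepF; rewrite !ler_norml; lra.
Unshelve. all: by end_near. Qed.
End helly_moments.

(** * Uniqueness of a law with given moments *)

Section law_determination.
Variable R : realType.
Implicit Types (X Y : randvar R) (f : R -> R).

Local Notation rv_cdf X := (@cdf _ _ _ (rv_prob X) (rv_fun X)).

Lemma same_law_cdf X Y : (forall r, rv_cdf X r = rv_cdf Y r) -> same_law X Y.
Proof.
move=> XY A mA; apply: (@measure_unique _ _ _ (@RGenOInfty.G R)
    (fun k : nat => `](- k%:R), +oo[%classic)) => //.
- exact: RGenOInfty.measurableE.
- move=> _ _ [x ->] [y ->]; exists (Num.max x y).
  by apply/seteqP; split=> z /=; rewrite !in_itv /= !andbT gt_max;
    [move=> [-> ->]|move=> /andP[]].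
- by move=> k; exists (- k%:R).
- rewrite -subTset => x _; exists (Num.truncn `|x|).+1 => //=.
  rewrite in_itv /= andbT ltrNl; apply: le_lt_trans (truncnS_gt _).
  by rewrite -normrN ler_norm.
- move=> _ [x ->]; transitivity (@ccdf _ _ _ (rv_prob X) (rv_fun X) x) => //.
  by rewrite ccdf_1_cdf XY -ccdf_1_cdf.
- move=> k; apply: (@le_lt_trans _ _ 1%E); last exact: ltry.
  exact: probability_le1.
Qed.

Lemma rv_cdf_ramp_le X r h : 0 < h ->
  (rv_cdf X r <= (rv_ev X (ramp r h))%:E <= rv_cdf X (r + h))%E.
Proof.
move=> h0.
have mX c : measurable (X @^-1` `]-oo, c]%classic) by exact: measurable_funPTI.
have bX : bounded_mfun (fun w => ramp r h (X w)).
  split; first by apply: measurableT_comp => //;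
    apply: continuous_measurable_fun; exact: continuous_ramp.
  by exists 1 => w; have := ramp_itv r h (X w); rewrite ler_norml; lra.
have indE c w : \1_(X @^-1` `]-oo, c]%classic) w = (X w <= c)%R%:R :> R.
  rewrite indicE (_ : (w \in _) = (X w <= c)) //.
  by apply/idP/idP; rewrite inE /= in_itv.
rewrite /cdf /distribution /pushforward -!ev_indic // !lee_fin.
apply/andP; split; apply: ev_le => [| |w] //; try exact: bounded_mfun_indic.
  rewrite indE; case: (leP (X w) r) => Xr; first by rewrite ramp_eq1.
  by case/andP: (ramp_itv r h (X w)).
rewrite indE; case: (leP (X w)) => Xr; first by case/andP: (ramp_itv r h (X w)).
by rewrite ramp_eq0 // ltW.
Qed.

(** By symmetry one inequality between distribution functions suffices: the ramp from r to s bounds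
    the first at r by the second at s, and s decreases to r. *)
Lemma same_law_continuous X Y : (forall f, continuous f -> bounded_fun f ->
  rv_ev X f = rv_ev Y f) -> same_law X Y.
Proof.
move=> XY; apply: same_law_cdf => r.
suff cdf_le X' Y' : (forall f, continuous f -> bounded_fun f ->
    rv_ev X' f = rv_ev Y' f) -> (rv_cdf X' r <= rv_cdf Y' r)%E.
  by apply/eqP; rewrite eq_le !cdf_le // => f cf bf; rewrite XY.
move=> {X Y XY}XY; apply: (cvge_to_ge (@cdf_right_continuous _ _ _ _ Y' r)).
near=> s.
have h0 : 0 < s - r by rewrite subr_gt0; near: s; exact: nbhs_right_gt.
have /andP[h1 _] := rv_cdf_ramp_le X' r h0; apply: (le_trans h1).
have /andP[_] := rv_cdf_ramp_le Y' r h0.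
rewrite (addrC r) subrK XY //; first exact: continuous_ramp.
exists 1; split; first exact: num_real.
move=> M M1 y _ /=; have := ramp_itv r (s - r) y.
by rewrite ler_norml; lra.
Unshelve. all: by end_near. Qed.

(** Convergence of moments is applied to the constant sequence X. *)
Lemma rv_within_uniq X Y a b : a < b -> rv_within a b X -> rv_within a b Y ->
  (forall k, (0 < k)%N ->
    rv_ev X (fun x => x ^+ k) = rv_ev Y (fun x => x ^+ k)) ->
  forall f, continuous f -> rv_ev X f = rv_ev Y f.
Proof.
move=> ab Xab Yab XY f cf.
have cvgX : rv_ev X f @[n --> \oo] --> rv_ev Y f.
  apply: (moments_cvg_ev (X := fun=> X) cf ab) => // k k0.
  by rewrite XY //; exact: cvg_cst.
exact: (cvg_unique _ (cvg_cst _) cvgX).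
Qed.

(* Bounded even moments force Y to lie in [-2, 2] almost surely. *)
Lemma same_law_moments X Y : rv_within 0 1 X ->
  (forall k, (0 < k)%N ->
    rv_expect Y (fun x => x ^+ k) = rv_expect X (fun x => x ^+ k)) ->
  same_law Y X.
Proof.
move=> X01 XY.
have bX k : bounded_mfun (fun w => X w ^+ k).
  by apply: bounded_mfunX; exact: rv_within_bounded X01.
pose B := [set w | (2%:E <= `|(Y w)%:E|)%E].
have mB : measurable B.
  rewrite (_ : B = (Num.norm \o Y) @^-1` `[2, +oo[%classic).
    have mY : measurable_fun setT (Num.norm \o Y).
      by apply: measurableT_comp => //; exact: normr_measurable.
    by rewrite -[X in measurable X]setTI; exact: mY.
  by apply/seteqP; split=> w; rewrite /B /= in_itv /= andbT lee_fin.
have PB0 : rv_prob Y B = 0%E.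
  have PBfin : rv_prob Y B \is a fin_num by exact: fin_num_measure.
  have PBk k : k.+1%:R <= 4 ^+ k.+1 :> R.
    elim: k => [|k IH]; first by lra.
    rewrite exprS -natr1; have : 1 <= k.+1%:R :> R by rewrite ler1n.
    lra.
  (* Markov's inequality for |Y| ^ (2 (k + 1)) at level 2; even powers of |Y| and Y coincide, and
     those of X have mean at most 1. Letting k grow forces the probability of [B] to be 0. *)
  have PBM k : ((4 ^+ k.+1)%:E * rv_prob Y B <= 1)%E.
    have lt02 : 0 < 2 :> R by lra.
    have := @markov _ _ _ (rv_prob Y) Y (fun x => x ^+ (2 * k.+1)) 2 lt02.
    rewrite exprM (_ : 2 ^+ 2 = 4 :> R); last by lra.
    move=> /(_ _ _ _)/le_trans; apply.
    - exact: exprn_measurable.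
    - by move=> r r0; rewrite exprn_ge0.
    - by move=> r t; rewrite !nnegrE => r0 t0 rt; exact: lerXn2r.
    rewrite (_ : _ \o _ = (fun x => x ^+ (2 * k.+1)) \o Y); last first.
      by apply/funext => w /=; rewrite exprM real_normK ?num_real // -exprM.
    rewrite -/(rv_expect Y _) XY // rv_expectE // lee_fin.
    rewrite -[leRHS](ev_cst (rv_prob X)); apply: ev_le => // [|w].
      exact: bounded_mfun_cst.
    by apply: exprn_ile1; case/andP: (X01 w).
  move: PBM (fine_ge0 (measure_ge0 (rv_prob Y) B)); rewrite -(fineK PBfin).
  move: (fine _) => q + q0; move: q0.
  rewrite le_eqVlt => /predU1P[<- //|q0] PBM; exfalso.
  have := PBM (Num.truncn q^-1); rewrite -EFinM lee_fin; apply/negP.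
  rewrite -ltNge; apply: (@lt_le_trans _ _ ((Num.truncn q^-1).+1%:R * q)).
    by rewrite -ltr_pdivrMr // mul1r truncnS_gt.
  by rewrite ler_pM2r.
(* The retraction of the line onto [-2, 2], which leaves Y unchanged off the null set [B]. *)
pose c : R -> R := fun x => 4 * clip01 ((x + 2) / 4) - 2.
have cc : continuous c.
  move=> x; apply: cvgB; last exact: cvg_cst.
  apply: cvgMr.
  apply: (@continuous_comp _ _ _ (fun x : R => (x + 2) / 4) (@clip01 R)).
    by apply: cvgMl; apply: cvgD; [exact: cvg_id|exact: cvg_cst].
  exact: continuous_clip01.
have mc : measurable_fun setT (c \o Y).
  by apply: measurableT_comp => //; exact: continuous_measurable_fun.
pose cY : {mfun rv_space Y >-> R} := HB.pack (c \o Y)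
  (isMeasurableFun.Build _ _ _ _ (c \o Y) mc).
pose Y' := RandVar (rv_prob Y) cY.
have Y'in : rv_within (-2) 2 Y'.
  by move=> w; have := clip01_itv ((Y w + 2) / 4); rewrite /= /c; lra.
have YY' f : continuous f -> rv_expect Y f = rv_expect Y' f.
  move=> cf; have mf := continuous_measurable_fun cf.
  rewrite /rv_expect unlock; apply: ae_eq_integral => //.
  - by apply/measurable_EFinP; exact: measurableT_comp.
  - by apply/measurable_EFinP; exact: measurableT_comp.
  - exists B; split => // w /= H; apply: contrapT => wB; apply: H => _.
    congr (f _)%:E; rewrite /= /c clip01_id; first by field.
    have : `|Y w| < 2.
      by rewrite ltNge; apply/negP => h; apply: wB; rewrite /B /= lee_fin.
    by rewrite ltr_norml => Yw; rewrite ler_pdivlMr ?ler_pdivrMr //; lra.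
have X22 : rv_within (-2) 2 X by move=> w; have := X01 w; lra.
have lt22 : -2 < 2 :> R by lra.
have bY' f : continuous f -> bounded_mfun (fun w => f (Y' w)).
  exact: rv_within_continuous Y'in.
have uniq := rv_within_uniq lt22 Y'in X22.
apply: same_law_continuous => f cf bf; rewrite -uniq //.
  apply: EFin_inj; rewrite -rv_expectE; last exact: bounded_mfun_rv.
  by rewrite YY' // rv_expectE //; exact: bY'.
move=> k k0; apply: EFin_inj.
rewrite -rv_expectE; last first.
  exact: (bY' (fun x => x ^+ k) (@exprn_continuous R k)).
by rewrite -YY'; [rewrite XY // rv_expectE|exact: exprn_continuous].
Qed.
End law_determination.

(** * The percolation identity *)

Lemma ev_finite (d : measure_display) (T : measurableType d) (R : realType)
    (P : probability T R) (I : finType) (Z : T -> I) (g : I -> R) :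
  (forall i, measurable (Z @^-1` [set i])) ->
  ev P (fun w => g (Z w)) = \sum_i g i * fine (P (Z @^-1` [set i])).
Proof.
move=> mZ.
have bI i : bounded_mfun (\1_(Z @^-1` [set i]) : T -> R).
  exact: bounded_mfun_indic.
transitivity (ev P (fun w => \sum_i g i * \1_(Z @^-1` [set i]) w)).
  congr (ev _ _); apply/funext => w; rewrite (bigD1 (Z w)) //= big1 ?addr0.
    by rewrite indicE mem_set // mulr1.
  by move=> i iZ; rewrite indicE memNset ?mulr0 //= => /esym; exact/eqP.
rewrite ev_sum => [|i]; last first.
  by apply: bounded_mfunM (bI i); exact: bounded_mfun_cst.
by apply: eq_bigr => i _; rewrite evZ // -ev_indic.
Qed.

Section percolation_identity.
Context (R : realType) (n : nat) (M : percolation_model R n).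

Let V := 'I_n.+1.
Let fseq (k : nat) (f : {ffun 'I_k -> V}) : seq V := [seq f i | i <- enum 'I_k].

Let weight (p : R) (t F : edges n) : R :=
  \prod_(e in t) (if e \in F then p else 1 - p).

(** Both sides count the k-tuples of vertices of the root cluster. *)
Lemma card_connected (k : nat) (F : edges n) :
  \sum_(f : {ffun 'I_k -> V}) (all (connect (adj F) ord0) (fseq f))%:R =
  (root_cluster_size F)%:R ^+ k :> R.
Proof.
rewrite -natr_sum -natrX; congr (_%:R).
transitivity
  #|ffun_on [set v | connect (adj F) ord0 v]%SET : pred {ffun 'I_k -> V}|.
  2: by rewrite card_ffun_on card_ord.
rewrite -sum1_card.
rewrite [RHS]big_mkcond /=; apply: eq_bigr => f _.
suff -> : (f \in ffun_on [set v | connect (adj F) ord0 v]%SET) =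
  all (connect (adj F) ord0) (fseq f) by case: all.
apply/ffun_onP/allP => [fF v /mapP[i _ ->]|fF i].
  by have := fF i; rewrite inE.
by rewrite inE; apply: fF; apply: map_f; rewrite mem_enum.
Qed.

(** Exchange the sums: for a fixed tuple of vertices, the sum over F is the probability that all
    bridges towards the tuple are kept. *)
Lemma tree_cluster_moment (k : nat) (p : R) (t : edges n) : is_tree t ->
  \sum_(F : edges n | F \subset t) weight p t F *
    ((root_cluster_size F)%:R / n.+1%:R) ^+ k =
  n.+1%:R^-1 ^+ k * \sum_(f : {ffun 'I_k -> V}) p ^+ reduced_length t (fseq f).
Proof.
move=> tT.
transitivity (n.+1%:R^-1 ^+ k * \sum_(F : edges n | F \subset t)
    \sum_(f : {ffun 'I_k -> V}) weight p t F *
      (all (connect (adj F) ord0) (fseq f))%:R).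
  rewrite mulr_sumr; apply: eq_bigr => F _.
  by rewrite -mulr_sumr card_connected exprMn; ring.
congr (_ * _); rewrite exchange_big /=; apply: eq_bigr => f _.
rewrite reduced_lengthE //.
have bt : (\bigcup_(v <- fseq f) bridges t v \subset t)%SET.
  rewrite -(all_connect_bridges _ tT (fintype.subxx t)).
  by apply/allP => v _; case: tT.
rewrite -(percolation_superset p bt) [RHS]big_mkcondr /=.
apply: eq_bigr => F Ft; rewrite (all_connect_bridges _ tT Ft).
by case: ifP; rewrite ?mulr1 ?mulr0.
Qed.

Lemma cluster_moment (k : nat) (p : R) : 0 <= p <= 1 ->
  ev (pm_prob M) (fun w => (root_cluster_fun p w / n.+1%:R) ^+ k) =
  ev (pm_prob M)
    (fun w => p ^+ reduced_length (tree w) (mkseq ((@vertex _ _ M)^~ w) k)).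
Proof.
move=> p01.
pose Z (w : pm_space M) := (tree w, (kept p w, [ffun i : 'I_k => vertex i w])).
have ZE w t F f : Z w = (t, (F, f)) <->
    [/\ tree w = t, kept p w = F & mkseq ((@vertex _ _ M)^~ w) k = fseq f].
  rewrite /Z /mkseq /fseq -val_enum_ord -map_comp; split.
    by case=> -> -> <-; split => //; apply: eq_map => i /=; rewrite ffunE.
  case=> -> -> /eq_in_map H; do 2 congr pair; apply/ffunP => i.
  by rewrite ffunE; apply: H; rewrite mem_enum.
have mZ i : measurable (Z @^-1` [set i]).
  case: i => t [F f].
  rewrite (_ : _ @^-1` _ = @tree _ _ M @^-1` [set t] `&`
      @kept _ _ M p @^-1` [set F] `&`
      \bigcap_(i in [set: 'I_k]) (@vertex _ _ M i @^-1` [set f i])).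
    apply: measurableI; first apply: measurableI.
    - exact: measurable_tree.
    - exact: measurable_kept.
    by apply: fin_bigcap_measurable => // i _; apply: measurable_vertex.
  apply/seteqP; split=> [w /= [<- <- <-] | w /= [[<- <-] fw]].
    by split=> // i _; rewrite /= ffunE.
  by do 2 congr pair; apply/ffunP => i; rewrite ffunE; apply: fw.
pose q t := fine (pm_prob M [set w | tree w = t]).
have PZ (t F : edges n) (f : {ffun 'I_k -> V}) : F \subset t ->
    fine (pm_prob M (Z @^-1` [set (t, (F, f))])) =
    q t * (weight p t F * n.+1%:R^-1 ^+ k).
  move=> Ft; rewrite (_ : _ @^-1` _ = [set w | [/\ tree w = t, kept p w = F
      & mkseq ((@vertex _ _ M)^~ w) (size (fseq f)) = fseq f]]); last first.
    by apply/seteqP; split=> w /=; rewrite /fseq size_map size_enum_ord => /ZE.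
  rewrite joint_law // fineM ?fin_num_measure //=; last exact: measurable_tree.
  by congr (_ * (_ * _)); rewrite big_map big_enum prodr_const card_ord.
have PZ0 (t F : edges n) (f : {ffun 'I_k -> V}) : ~~ (F \subset t) ->
    pm_prob M (Z @^-1` [set (t, (F, f))]) = 0%E.
  move=> Ft; rewrite (_ : _ @^-1` _ = set0) ?measure0 // -subset0 => w.
  case/ZE => tE FE _.
  by case/negP: Ft; rewrite -tE -FE kept_sub.
have evZE (g : edges n -> edges n -> {ffun 'I_k -> V} -> R) :
    ev (pm_prob M) (fun w => g (Z w).1 (Z w).2.1 (Z w).2.2) =

    \sum_t q t * \sum_(F : edges n | F \subset t) weight p t F *
       (n.+1%:R^-1 ^+ k * \sum_f g t F f).
  rewrite (ev_finite _ (fun z => g z.1 z.2.1 z.2.2) mZ).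
  pose h t F f := g t F f * fine (pm_prob M (Z @^-1` [set (t, (F, f))])).
  transitivity (\sum_z h z.1 z.2.1 z.2.2).
    by apply: eq_bigr => -[t [F f]].
  rewrite -(pair_bigA _ (fun t y => h t y.1 y.2)) /=; apply: eq_bigr => t _.
  rewrite -(pair_bigA _ (h t)) /= mulr_sumr.
  rewrite [RHS]big_mkcond /=; apply: eq_bigr => F _; case: ifPn => Ft.
    by rewrite !mulr_sumr; apply: eq_bigr => f _; rewrite /h PZ //; ring.
  by rewrite big1 // => f _; rewrite /h PZ0 // mulr0.
rewrite (evZE (fun t F f => ((root_cluster_size F)%:R / n.+1%:R) ^+ k)).
transitivity (ev (pm_prob M)
    (fun w => p ^+ reduced_length (Z w).1 (fseq (Z w).2.2))).
  rewrite (evZE (fun t F f => p ^+ reduced_length t (fseq f))).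
  apply: eq_bigr => t _; have [tT|tN] := pselect (is_tree t); last first.
    have -> : q t = 0; last by rewrite !mul0r.
    rewrite /q (_ : [set w | _] = set0) ?measure0 // -subset0 => w tE.
    by apply: tN; rewrite -tE; exact: treeP.
  congr (_ * _).
  have nk : n.+1%:R^-1 ^+ k * (n.+1 ^ k)%:R = 1 :> R.
    by rewrite natrX -exprMn mulVf ?expr1n.
  rewrite -[RHS]mulr_suml.
  (* The reduced length does not depend on F, so the weights sum to 1: the case of an empty set of
     required edges. Dually, the cluster size does not depend on the tuple, whence the factor (n +
     1) ^ k removed below. *)
  have W1 : \sum_(F : edges n | F \subset t) weight p t F = 1.
    rewrite -(expr0 p) -(@cards0 (set_of 'I_n.+1)).
    rewrite -(percolation_superset p (finset.sub0set t)).
    by apply: eq_bigl => F; rewrite finset.sub0set andbT.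
  rewrite W1 mul1r -tree_cluster_moment //; apply: eq_bigr => F _.
  have nkE (x : R) : n.+1%:R^-1 ^+ k * (x *+ (n.+1 ^ k)) = x.
    by rewrite -(mulr_natr x) mulrCA nk mulr1.
  by rewrite sumr_const card_ffun !card_ord nkE.
have -> // : (fun w => p ^+ reduced_length (Z w).1 (fseq (Z w).2.2)) =
  (fun w => p ^+ reduced_length (tree w) (mkseq ((@vertex _ _ M)^~ w) k)).
apply/funext => w; congr (_ ^+ reduced_length _ _).
by case: (ZE w (Z w).1 (Z w).2.1 (Z w).2.2) => -[].
Qed.
End percolation_identity.

(** * Laplace transforms *)

Lemma cvg_in_lawP (R : realType) (X : nat -> randvar R) (Y : randvar R) :
  cvg_in_law X Y <-> forall f, continuous f -> bounded_fun f ->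
    rv_ev (X n) f @[n --> \oo] --> rv_ev Y f.
Proof.
split=> XY f cf bf.
  have := XY f cf bf; rewrite rv_expectE; last exact: bounded_mfun_rv.
  exact: fine_cvg.
rewrite rv_expectE; last exact: bounded_mfun_rv.
apply: cvg_EFin; last exact: XY.
by apply: nearW => n; rewrite rv_expectE //; exact: bounded_mfun_rv.
Qed.

Section exponential.
Variable R : realType.
Implicit Types (X : randvar R) (c x y : R).

(* The absolute value makes [expc c] bounded on the whole line. *)
Definition expc c x : R := expR (- (c * `|x|)).

Lemma expc_gt0 c x : 0 < expc c x. Proof. exact: expR_gt0. Qed.

Lemma expc_le1 c x : 0 <= c -> expc c x <= 1.
Proof. by move=> c0; rewrite /expc expR_le1 oppr_le0 mulr_ge0. Qed.

Lemma continuous_expc c : continuous (expc c).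
Proof.
move=> x; apply: (@continuous_comp _ _ _ (fun x : R => - (c * `|x|)) expR).
  2: exact: continuous_expR.
by apply: cvgN; apply: cvgMr; exact: norm_continuous.
Qed.

Lemma bounded_expc c : 0 <= c -> bounded_fun (expc c).
Proof.
move=> c0; exists 1; split; first exact: num_real.
move=> M M1 x _ /=; rewrite ger0_norm ?expR_ge0 //.
by rewrite (le_trans (expc_le1 _ c0)) // ltW.
Qed.

Lemma bounded_mfun_expc X c : 0 <= c -> bounded_mfun (fun w => expc c (X w)).
Proof.
move=> c0; apply: bounded_mfun_rv; first exact: continuous_expc.
exact: bounded_expc.
Qed.

(** Together with [expR_ge1Dx] this encloses exp (- x) between 1 - x and 1 / (1 + x), which is how
    exponentials are compared with 1 - c / ell n below. *)
Lemma expR_le_inv1D x : 0 <= x -> expR (- x) <= (1 + x)^-1.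
Proof.
move=> x0; rewrite expRN lef_pV2 ?posrE ?expR_gt0 //; last lra.
exact: expR_ge1Dx.
Qed.

Lemma expcD_le c h x : 0 <= c -> 0 <= h ->
  expc c x - expc (c + h) x <= 1 - expc h x.
Proof.
move=> c0 h0; rewrite /expc mulrDl opprD expRD.
have := expc_le1 x c0; have := expc_gt0 c x; have := expc_gt0 h x.
have := expc_le1 x h0; rewrite /expc; nra.
Qed.

Lemma expc_antitone c h x : c <= h -> expc h x <= expc c x.
Proof. by move=> ch; rewrite /expc ler_expR lerN2 ler_wpM2r. Qed.

Lemma tail_ev X e : 0 < e -> (forall w, 0 <= X w) ->
  exists2 t, 0 < t & exists2 A : set (rv_space X), measurable A &
    ev (rv_prob X) \1_A <= e /\ forall w, X w <= t \/ A w.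
Proof.
move=> e0 X0; have := @cvg_cdfy1 _ _ _ (rv_prob X) (rv_fun X).
move=> /fine_cvg/cvgrPdist_le/(_ _ e0)[T [_ HT]].
pose t := Num.max 1 (T + 1).
have t0 : 0 < t by rewrite /t lt_max ltr01.
have Tt : T < t by rewrite /t lt_max ltrDl ltr01 orbT.
exists t => //; exists (X @^-1` `]t, +oo[%classic).
  exact: measurable_funPTI.
split; last first.
  by move=> w; case: (leP (X w) t) => h; [left|right; rewrite /= in_itv /= h].
have := HT t Tt; rewrite /= -[leLHS]ger0_norm //.
rewrite normr_id; have := @cdf_ccdf_1 _ _ _ (rv_prob X) (rv_fun X) t.
have mA : measurable (X @^-1` `]t, +oo[%classic) by exact: measurable_funPTI.
have mB : measurable (X @^-1` `]-oo, t]%classic) by exact: measurable_funPTI.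
rewrite /cdf /ccdf /distribution /pushforward -!ev_indic // -EFinD => -[] <-.
rewrite /= (addrC (ev _ _)) addrK.
exact: le_trans (ler_norm _).
Qed.

Definition laplace X c := rv_ev X (expc c).

(** X stays below some t with probability at least 1 / 2, and there exp (- c X) >= exp (- c t).
    Applied to L_1 it shows that G(c) is not almost surely 0. *)
Lemma laplace_gt0 X c : 0 <= c -> (forall w, 0 <= X w) -> 0 < laplace X c.
Proof.
move=> c0 X0; have e0 : 0 < 1 / 2 :> R by lra.
have [t t0 [A mA [evA XA]]] := tail_ev e0 X0.
have bA := @bounded_mfun_indic _ (rv_space X) R A mA.
apply: (@lt_le_trans _ _ (expR (- (c * t)) * (1 / 2))).
  by rewrite mulr_gt0 ?expR_gt0.
apply: (@le_trans _ _
    (ev (rv_prob X) (fun w => expR (- (c * t)) * (1 - \1_A w)))).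
  rewrite evZ; last by apply: bounded_mfunB => //; exact: bounded_mfun_cst.
  rewrite evB ?ev_cst //; last exact: bounded_mfun_cst.
  by rewrite ler_wpM2l ?expR_ge0 //; lra.
apply: ev_le => [||w].
- apply: bounded_mfunM; first exact: bounded_mfun_cst.
  by apply: bounded_mfunB => //; exact: bounded_mfun_cst.
- exact: bounded_mfun_expc.
- case: (XA w) => [Xt|Aw]; last first.
    by rewrite indicE mem_set // subrr mulr0 expR_ge0.
  apply: (@le_trans _ _ (expR (- (c * t)))).
    by rewrite ler_piMr ?expR_ge0 // indicE gerBl.
  by rewrite ler_expR lerN2 ler_wpM2l // ger0_norm.
Qed.

Lemma laplace_antitone X c h : 0 <= c -> c <= h -> laplace X h <= laplace X c.
Proof.
move=> c0 ch; apply: ev_le => [||w].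
- by apply: bounded_mfun_expc; exact: le_trans ch.
- exact: bounded_mfun_expc.
- exact: expc_antitone.
Qed.

Lemma laplace_near0 X e : 0 < e -> (forall w, 0 <= X w) ->
  exists2 d, 0 < d & 1 - laplace X d <= e.
Proof.
move=> e0 X0; have e20 : 0 < e / 2 by lra.
have [t t0 [A mA [evA XA]]] := tail_ev e20 X0.
have bA := @bounded_mfun_indic _ (rv_space X) R A mA.
(* Where X <= t, 1 - exp (- d X) <= d t = e / 2; the tail event costs the other half. *)
pose d := e / 2 / t; have d0 : 0 < d by rewrite divr_gt0.
have dt : d * t = e / 2 by rewrite /d divfK // gt_eqF.
exists d => //.
rewrite -[1](ev_cst (rv_prob X)) -evB //; last 2 first.
- exact: bounded_mfun_cst.
- by apply: bounded_mfun_expc; exact: ltW.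
apply: (@le_trans _ _ (ev (rv_prob X) (fun w => e / 2 + \1_A w))); last first.
  by rewrite evD ?ev_cst //; [lra|exact: bounded_mfun_cst].
apply: ev_le => [||w].
- apply: bounded_mfunB; first exact: bounded_mfun_cst.
  by apply: bounded_mfun_expc; exact: ltW.
- by apply: bounded_mfunD => //; exact: bounded_mfun_cst.
- case: (XA w) => [Xt|Aw]; last first.
    have -> : \1_A w = 1 :> R by rewrite indicE mem_set.
    by have := expc_gt0 d (X w); lra.
  have : 1 + - (d * `|X w|) <= expc d (X w) by exact: expR_ge1Dx.
  rewrite ger0_norm //; have : d * X w <= d * t by rewrite ler_wpM2l // ltW.
  have : 0 <= \1_A w :> R by [].
  by rewrite dt; lra.
Qed.

Lemma laplaceD_le X c h : 0 <= c -> 0 <= h ->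
  laplace X c - laplace X (c + h) <= 1 - laplace X h.
Proof.
move=> c0 h0; have ch0 : 0 <= c + h by rewrite addr_ge0.
rewrite -[1](ev_cst (rv_prob X)) -!evB; try exact: bounded_mfun_expc;
  try exact: bounded_mfun_cst.
apply: ev_le => [||w]; last exact: expcD_le.
- by apply: bounded_mfunB; exact: bounded_mfun_expc.
- by apply: bounded_mfunB; [exact: bounded_mfun_cst|exact: bounded_mfun_expc].
Qed.

End exponential.

(** * Comparison of the regime with exponentials *)

Section regime.
Context (R : realType) (ell : nat -> R) (ell_cvg : ell n @[n --> \oo] --> +oo).
Implicit Types (c d : R) (p : nat -> R).

Lemma near_ell A : \forall n \near \oo, A <= ell n.
Proof. by move/cvgryPge : ell_cvg; exact. Qed.

(** The maximum with 0 keeps the parameter in the range where [expc] is bounded; when c <= d the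
    upper bound is just p n <= 1. *)
Lemma regime_bounds c d p : in_regime ell c p -> 0 <= c -> 0 < d ->
  \forall n \near \oo, expR (- ((c + d) / ell n)) <= p n <=
    expR (- (Num.max (c - d) 0 / ell n)).
Proof.
move=> [p01 /eqaddoP pc] c0 d0.
have d20 : 0 < d / 2 by lra.
(* The second threshold is what makes (1 - (c + d / 2) / l) (1 + (c + d) / l) >= 1 for l = ell n. *)
have := near_ell (Num.max 1 (2 * (c + d / 2) * (c + d) / d)).
have := nbhs_infty_gt 0%N; have := pc _ d20.
apply: filterS3 => n /= pn n0; rewrite ge_max => /andP[l1 ln].
have l0 : 0 < ell n by lra.
have x0 : 0 < (ell n)^-1 by rewrite invr_gt0.
rewrite (gtr0_norm x0) in pn; move: pn; rewrite ler_norml !fctE => pn.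
have p1 : p n <= 1 by case/andP: (p01 n n0).
apply/andP; split.
  have y0 : 0 <= (c + d) / ell n by rewrite divr_ge0 //; lra.
  apply: (le_trans (expR_le_inv1D y0)).
  have key : 1 - (c + d / 2) / ell n <= p n by lra.
  apply: (le_trans _ key); rewrite -div1r ler_pdivrMr; last by lra.
  have lx : ell n * (ell n)^-1 = 1 by rewrite divff // gt_eqF.
  have : 2 * (c + d / 2) * (c + d) <= ell n * d by rewrite -ler_pdivrMr.
  move: (ell n) ((ell n)^-1) l0 x0 lx => l x l0 x0 lx h.
  have h' : 2 * (c + d / 2) * (c + d) * x <= l * d * x by rewrite ler_pM2r.
  rewrite (mulrAC l) lx mul1r in h'.
  have : 2 * (c + d / 2) * (c + d) * x * x <= d * x by rewrite ler_pM2r.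
  by nra.
case: (leP (c - d) 0) => cd; first by rewrite mul0r oppr0 expR0.
apply: le_trans (expR_ge1Dx _).
have : 0 < d / 2 / ell n by rewrite divr_gt0.
lra.
Qed.

Lemma expR_in_regime c : (forall n, (0 < n)%N -> 0 <= ell n) -> 0 <= c ->
  in_regime ell c (fun n => expR (- (c / ell n))).
Proof.
move=> ell_ge0 c0; split=> [n n0|].
  by rewrite expR_ge0 expR_le1 oppr_le0 divr_ge0 // ell_ge0.
apply/eqaddoP => e e0.
(* With y = c / ell n, exp (- y) - (1 - y) lies between 0 and y ^ 2, and this threshold makes y ^ 2
   <= e / ell n. *)
have := near_ell (c ^+ 2 / e); have := near_ell 1.
apply: filterS2 => n l1 ln.
have l0 : 0 < ell n by lra.
have x0 : 0 < (ell n)^-1 by rewrite invr_gt0.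
rewrite (gtr0_norm x0) !fctE.
have y0 : 0 <= c / ell n by rewrite divr_ge0 // ltW.
have h1 := expR_le_inv1D y0; have h2 := expR_ge1Dx (- (c / ell n)).
have : c ^+ 2 <= ell n * e by rewrite -ler_pdivrMr.
have lx : ell n * (ell n)^-1 = 1 by rewrite divff // gt_eqF.
have h3 : (1 + c / ell n)^-1 <= 1 - c / ell n + (c / ell n) ^+ 2.
  rewrite -div1r ler_pdivrMr; last by lra.
  by move: (c / ell n) y0 => y y0; nra.
move=> h4.
have h5 : (c / ell n) ^+ 2 <= e / ell n.
  move: (ell n) ((ell n)^-1) l0 x0 lx h4 => l x l0 x0 lx h4.
  have h' : c ^+ 2 * x <= l * e * x by rewrite ler_pM2r.
  rewrite (mulrAC l) lx mul1r in h'.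
  have : c ^+ 2 * x * x <= e * x by rewrite ler_pM2r.
  by nra.
rewrite ger0_norm; lra.
Qed.

End regime.

(** * A continuity theorem for Laplace transforms *)

Section laplace_continuity.
Context (R : realType) (T : nat -> randvar R) (psi : R -> R).
Context (T_ge0 : forall n, (0 < n)%N -> forall w, 0 <= T n w).
Context (T_psi : forall c, 0 < c -> laplace (T n) c @[n --> \oo] --> psi c).
Context (psi_near0 : forall e, 0 < e -> exists2 c, 0 < c & 1 - psi c <= e).

(* Y_n = exp(- T_n) lies in [0, 1] and its moments are values of the Laplace
   transform of T_n, so Y_n has a limit Y in law; psi(0+) = 1 prevents Y from
   charging 0, so that - ln Y is the limit of T_n. *)
Lemma laplace_continuity :
  exists L : randvar R, (forall w, 0 <= L w) /\ cvg_in_law T L.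
Proof.
have mE n : measurable_fun setT (expc 1 \o T n).
  apply: measurableT_comp => //; apply: continuous_measurable_fun.
  exact: continuous_expc.
pose Yf n : {mfun rv_space (T n) >-> R} := HB.pack (expc 1 \o T n)
  (isMeasurableFun.Build _ _ _ _ (expc 1 \o T n) (mE n)).
pose Yn n := RandVar (rv_prob (T n)) (Yf n).
have Yn01 n : rv_within 0 1 (Yn n).
  by move=> w; rewrite /= ltW ?expc_gt0 // expc_le1.
have Ynk n k : rv_ev (Yn n) (fun x => x ^+ k) = laplace (T n) k%:R.
  rewrite /laplace /rv_ev /=; congr (fine (expectation _ _)); apply/funext => w.
  by rewrite /expc mul1r -expRM_natl mulrN.
have [k|Y [Y01 YnY]] := moment_limit Yn01.
  under eq_fun do rewrite Ynk.
  have [->|k0] := posnP k; last by apply: cvgP; apply: T_psi; rewrite ltr0n.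
  have L0 n : laplace (T n) 0 = 1.
    rewrite /laplace /rv_ev -[RHS](ev_cst (rv_prob (T n)) 1).
    congr (fine (expectation _ _)); apply/funext => w.
    by rewrite /expc mul0r oppr0 expR0.
  by under eq_fun do rewrite L0; exact: is_cvg_cst.
have YnY_cont f : continuous f -> rv_ev (Yn n) f @[n --> \oo] --> rv_ev Y f.
  by move=> cf; apply: (moments_cvg_ev cf ltr01 Yn01 Y01).
(* Where Y w = 0 this takes the default value of [ln]; such points enter only through the error 1 -
   [chi], which is small on average. *)
have mL : measurable_fun setT (fun w => - ln (Y w)).
  by apply: measurableT_comp => //; apply: measurableT_comp => //;
    exact: measurable_ln.
pose Lf : {mfun rv_space Y >-> R} := HB.pack (fun w => - ln (Y w))
  (isMeasurableFun.Build _ _ _ _ (fun w => - ln (Y w)) mL).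
exists (RandVar (rv_prob Y) Lf); split=> [w|].
  by rewrite /= oppr_ge0 ln_le0 //; case/andP: (Y01 w).
apply/cvg_in_lawP => f cf bf.
have [B B0 fB] : exists2 B, 0 < B & forall x, `|f x| <= B.
  have [B [_ HB]] := bf; exists (Num.max 1 (B + 1)).
    by rewrite lt_max ltr01.
  by move=> x; apply: HB => //; rewrite lt_max ltrDl ltr01 orbT.
apply/cvgrPdist_le => e e0.
(* The final estimate adds 8 B e', e' / 2 and 12 B e', which fits into this budget. *)
pose e' := e / (32 * B + 1).
have B1 : 0 < 32 * B + 1 by lra.
have e'0 : 0 < e' by rewrite divr_gt0.
have ee' : e = 32 * B * e' + e' by rewrite /e'; field; lra.
have [c c0 psic] := psi_near0 e'0.
(* Y_n < 2 d then means c |T_n| > 1, so exp (- c |T_n|) <= 1 / 2 and 1 - chi (Y_n) <= 1 <= 2 (1 -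
   exp (- c |T_n|)); this is [chi_tail]. *)
pose d := expR (- c^-1) / 2.
have d0 : 0 < d by rewrite divr_gt0 ?expR_gt0.
pose chi (y : R) : R := clip01 (y / (2 * d)).
have c_chi : continuous chi.
  move=> y.
  apply: (@continuous_comp _ _ _ (fun y : R => y / (2 * d)) (@clip01 R)).
    by apply: cvgMl; exact: cvg_id.
  exact: continuous_clip01.
(* Cutting y off below d removes the singularity of ln at 0. For y < d the change is at most 2 B
   while 1 - [chi] is at least 1 / 2, whence the factor 4 B in [fg]. *)
pose g (y : R) : R := f (- ln (Num.max y d)).
have cg : continuous g.
  move=> y; apply: (@continuous_comp _ _ _ (fun y : R => - ln (Num.max y d)) f).
    2: exact: cf.
  apply: cvgN.
  apply: (@continuous_comp _ _ _ (fun y : R => Num.max y d) (@ln R)).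
    by apply: continuous_max; [exact: cvg_id|exact: cvg_cst].
  by apply: continuous_ln; rewrite lt_max d0 orbT.
have fg y : `|f (- ln y) - g y| <= 4 * B * (1 - chi y).
  have chi01 := clip01_itv (y / (2 * d)).
  rewrite /g; have [dy|yd] := leP d y.
    rewrite subrr normr0 mulr_ge0 //; first by lra.
    by rewrite /chi; lra.
  have : chi y <= 1 / 2.
    apply: (@le_trans _ _ (clip01 (1 / 2))); last by rewrite clip01_id //; lra.
    by apply: le_clip01; rewrite ler_pdivrMr; lra.
  have := fB (- ln y); have := fB (- ln d); rewrite !ler_norml.
  move: (chi y) => z; nra.
have bYn n (h : R -> R) : continuous h -> bounded_mfun (fun w => h (Yn n w)).
  exact: rv_within_continuous (Yn01 n).
have bY (h : R -> R) : continuous h -> bounded_mfun (fun w => h (Y w)).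
  exact: rv_within_continuous Y01.
have chi_tail n : 1 - rv_ev (Yn n) chi <= 2 * (1 - laplace (T n) c).
  have bc := bounded_mfun_expc (T n) (ltW c0).
  have b1 : bounded_mfun (fun _ : rv_space (T n) => 1 : R).
    exact: bounded_mfun_cst.
  have b2 : bounded_mfun (fun _ : rv_space (Yn n) => 1 : R).
    exact: bounded_mfun_cst.
  rewrite -[X in X - _](ev_cst (rv_prob (Yn n))).
  rewrite -[X in 2 * (X - _)](ev_cst (rv_prob (T n))).
  rewrite -!evB //; last exact: bYn.
  rewrite -evZ; last exact: bounded_mfunB.
  apply: ev_le => [||w].
  - by apply: bounded_mfunB => //; exact: bYn.
  - by apply: bounded_mfunM; [exact: bounded_mfun_cst|exact: bounded_mfunB].
  - have cT := expc_le1 (T n w) (ltW c0).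
    have [dY|Yd] := leP (2 * d) (Yn n w).
      by rewrite /chi clip01_ge1 ?subrr; [lra|rewrite ler_pdivlMr; lra].
    have : expc c (T n w) <= 1 / 2; last first.
      have := clip01_itv (Yn n w / (2 * d)).
      rewrite -/(chi _) => /andP[chi0 _] h.
      lra.
    move: Yd; rewrite /d mulrC divfK ?pnatr_eq0 //.
    rewrite /= /expc mul1r ltr_expR ltrN2.
    move=> cT'; apply: (@le_trans _ _ (expR (- 1))).
      rewrite ler_expR lerN2; apply: ltW.
      by rewrite -ltr_pdivrMl // mulr1.
    apply: (le_trans (expR_le_inv1D ler01)); rewrite -div1r; lra.
have chi_lim : 1 - rv_ev Y chi <= 2 * e'.
  apply: (@le_trans _ _ (2 * (1 - psi c))); last by lra.
  apply: (@ler_cvg_to _ (\oo) _ _ (fun n => 1 - rv_ev (Yn n) chi)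
     (fun n => 2 * (1 - laplace (T n) c))).
  - by apply: cvgB; [exact: cvg_cst|exact: YnY_cont].
  - by apply: cvgMr; apply: cvgB; [exact: cvg_cst|exact: T_psi].
  - by apply: nearW => n; exact: chi_tail.
have e20 : 0 < e' / 2 by lra.
have near1 := nbhs_infty_gt 0%N.
move/cvgrPdist_le : (YnY_cont _ cg) => /(_ _ e20) near2.
move/cvgrPdist_le : (YnY_cont _ c_chi) => /(_ _ e20) near3.
near=> n.
have n0 : (0 < n)%N by near: n.
have H2 : `|rv_ev Y g - rv_ev (Yn n) g| <= e' / 2 by near: n.
have H3 : `|rv_ev Y chi - rv_ev (Yn n) chi| <= e' / 2 by near: n.
have bchi (h : R -> R) (P : randvar R) : bounded_mfun (fun w => h (P w)) ->
    bounded_mfun (fun w => 4 * B * (1 - h (P w))).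
  move=> bh; apply: bounded_mfunM; first exact: bounded_mfun_cst.
  by apply: bounded_mfunB => //; exact: bounded_mfun_cst.
have ev_chi (h : R -> R) (P : randvar R) : bounded_mfun (fun w => h (P w)) ->
    ev (rv_prob P) (fun w => 4 * B * (1 - h (P w))) = 4 * B * (1 - rv_ev P h).
  move=> bh; rewrite evZ; last first.
    by apply: bounded_mfunB => //; exact: bounded_mfun_cst.
  by rewrite evB ?ev_cst //; exact: bounded_mfun_cst.
have H4 : `|rv_ev (RandVar (rv_prob Y) Lf) f - rv_ev Y g| <=
    4 * B * (1 - rv_ev Y chi).
  rewrite -ev_chi; last exact: bY.
  apply: ev_dist_le => [|||w]; last exact: fg.
  - exact: (@bounded_mfun_rv _ (RandVar (rv_prob Y) Lf)).
  - exact: bY.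
  - exact: (bchi chi Y (bY chi c_chi)).
have H5 : `|rv_ev (T n) f - rv_ev (Yn n) g| <= 4 * B * (1 - rv_ev (Yn n) chi).
  rewrite -ev_chi; last exact: bYn.
  apply: ev_dist_le => [|||w].
  - exact: bounded_mfun_rv.
  - exact: bYn.
  - exact: (bchi chi (Yn n) (bYn n chi c_chi)).
  - suff {1}-> : T n w = - ln (Yn n w) by exact: fg.
    by rewrite /= /expc mul1r expRK opprK ger0_norm // T_ge0.
have : 4 * B * (1 - rv_ev Y chi) <= 4 * B * (2 * e').
  by rewrite ler_wpM2l //; lra.
have : 4 * B * (1 - rv_ev (Yn n) chi) <= 4 * B * (3 * e').
  by rewrite ler_wpM2l //; move: H3; rewrite ler_norml; lra.
by move: H2 H4 H5; rewrite ee' !ler_norml; lra.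
Unshelve. all: by end_near. Qed.

End laplace_continuity.

(** * The two directions *)

Section main.
Context (R : realType) (ell : nat -> R).
Context (ell_ge0 : forall n, (0 < n)%N -> 0 <= ell n).
Context (ell_cvg : ell n @[n --> \oo] --> +oo).
Context (M : forall n, percolation_model R n).
Implicit Types (p : nat -> R) (c : R).

(** [X] has the normalization of the theorem, [Z] that of the exact moment identity. *)
Let X p n := rv_scale n%:R^-1 (root_cluster_rv (M n) (p n)).
Let Z p n := rv_scale n.+1%:R^-1 (root_cluster_rv (M n) (p n)).
Let T k n := rv_scale (ell n)^-1 (reduced_length_rv (M n) k).

Let cluster_le n (F : edges n) : (root_cluster_size F)%:R <= n.+1%:R :> R.
Proof. by rewrite ler_nat -[X in (_ <= X)%N](card_ord n.+1) max_card. Qed.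

Lemma Z_within p n : rv_within 0 1 (Z p n).
Proof.
move=> w; rewrite /= /root_cluster_fun; apply/andP; split.
  by rewrite mulr_ge0 ?invr_ge0.
by rewrite ler_pdivrMl ?ltr0n // mulr1 cluster_le.
Qed.

Lemma X_within p n : rv_within 0 2 (X p n).
Proof.
move=> w.
rewrite -[X p n w]/(n%:R^-1 * (root_cluster_size (kept (p n) w))%:R).
have := cluster_le (kept (p n) w); move: (root_cluster_size _) => C Cn.
apply/andP; split; first by rewrite mulr_ge0 ?invr_ge0.
(* At n = 0 the inverse is 0 by convention, so the bound holds at every index, as [moments_cvg_ev]
   requires. *)
have [n0|n0] := posnP n; first by rewrite n0 invr0 mul0r.
rewrite ler_pdivrMl ?ltr0n //; apply: (le_trans Cn).
by rewrite -natrM ler_nat muln2 -addnn -addn1 leq_add2l.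
Qed.

Lemma X_moment p n k : (0 < n)%N -> rv_ev (X p n) (fun x => x ^+ k) =
  (n.+1%:R / n%:R) ^+ k * rv_ev (Z p n) (fun x => x ^+ k).
Proof.
move=> n0; rewrite -evZ; last first.
  by apply: bounded_mfunX; exact: rv_within_bounded (@Z_within p n).
rewrite /rv_ev; congr (fine (expectation _ _)); apply/funext => w.
rewrite -exprMn -[X p n w]/(n%:R^-1 * (root_cluster_size (kept (p n) w))%:R).
rewrite -[Z p n w]/(n.+1%:R^-1 * (root_cluster_size (kept (p n) w))%:R).
congr (_ ^+ _); rewrite mulrA; congr (_ * _).
by rewrite mulrAC mulfV ?mul1r // pnatr_eq0.
Qed.

Lemma cvg_ratio k : (n.+1%:R / n%:R) ^+ k @[n --> \oo] --> (1 : R).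
Proof.
rewrite -[X in _ --> X](expr1n _ k).
apply: (@cvg_comp _ _ _ _ (fun x : R => x ^+ k)); last exact: exprn_continuous.
have H : (fun n => 1 + @harmonic R n) @ \oo --> (1 : R).
  rewrite -[X in _ --> X]addr0; apply: cvgD; first exact: cvg_cst.
  exact: cvg_harmonic.
rewrite -cvg_shiftS; apply: cvg_trans H; apply: near_eq_cvg; apply: nearW => n.
by rewrite /harmonic /= -[n.+2]addn1 natrD mulrDl mul1r divff ?pnatr_eq0.
Qed.

Lemma X_moments_cvg p k (m : R) :
  rv_ev (X p n) (fun x => x ^+ k) @[n --> \oo] --> m <->
  rv_ev (Z p n) (fun x => x ^+ k) @[n --> \oo] --> m.
Proof.
pose r n : R := (n.+1%:R / n%:R) ^+ k.
have cr : r n @[n --> \oo] --> (1 : R) := cvg_ratio k.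
split=> cm.
  have H : (r n)^-1 * rv_ev (X p n) (fun x => x ^+ k) @[n --> \oo] --> m.
    rewrite -[m]mul1r -[X in _ --> X * m]invr1.
    by apply: cvgM cm; apply: cvgV => //; exact: oner_neq0.
  apply: cvg_trans H; apply: near_eq_cvg.
  apply: filterS (nbhs_infty_gt 0%N) => n n0.
  have r0 : r n != 0.
    by rewrite expf_neq0 // mulf_neq0 // ?invr_eq0 pnatr_eq0 // -lt0n.
  by rewrite /= X_moment // mulKf.
have H : r n * rv_ev (Z p n) (fun x => x ^+ k) @[n --> \oo] --> m.
  by rewrite -[m]mul1r; apply: cvgM.
apply: cvg_trans H; apply: near_eq_cvg.
by apply: filterS (nbhs_infty_gt 0%N) => n n0; rewrite X_moment.
Qed.

Lemma Z_laplace p n k c : (0 < n)%N -> 0 <= c -> p n = expR (- (c / ell n)) ->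
  rv_ev (Z p n) (fun x => x ^+ k) = laplace (T k n) c.
Proof.
move=> n0 c0 pE.
have p01 : 0 <= p n <= 1.
  by rewrite pE expR_ge0 expR_le1 oppr_le0 divr_ge0 // ell_ge0.
transitivity (ev (pm_prob (M n))
    (fun w => (root_cluster_fun (p n) w / n.+1%:R) ^+ k)).
  rewrite /rv_ev; congr (fine (expectation _ _)); apply/funext => w.
  by rewrite /= mulrC.
rewrite cluster_moment // /laplace /rv_ev.
congr (fine (expectation _ _)); apply/funext => w.
rewrite -[T k n w]/((ell n)^-1 * (reduced_length_fun k w)) pE -expRM_natl /expc.
rewrite ger0_norm; last by rewrite mulr_ge0 // invr_ge0 ell_ge0.
by congr expR; rewrite /reduced_length_fun; ring.
Qed.

Lemma T_ge0 k n : (0 < n)%N -> forall w, 0 <= T k n w.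
Proof. by move=> n0 w; rewrite /= mulr_ge0 // invr_ge0 ell_ge0. Qed.

(** Any positive p n equals exp (- (a / ell n)) for some a, so the moment is exactly a Laplace
    transform at a, and d <= a <= c. *)
Lemma Z_laplace_bounds p n k c d : (0 < n)%N -> 0 < ell n ->
  0 <= p n <= 1 -> 0 <= d ->
  expR (- (c / ell n)) <= p n <= expR (- (d / ell n)) ->
  laplace (T k n) c <= rv_ev (Z p n) (fun x => x ^+ k) <= laplace (T k n) d.
Proof.
move=> n0 l0 p01 d0 /andP[cp pd].
have p0 : 0 < p n by apply: lt_le_trans cp; exact: expR_gt0.
pose a := - ln (p n) * ell n.
have pE : p n = expR (- (a / ell n)).
  by rewrite /a mulfK ?gt_eqF // opprK lnK.
rewrite pE !ler_expR !lerN2 !ler_pM2r ?invr_gt0 // in cp pd.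
rewrite (Z_laplace _ n0 (le_trans d0 pd) pE).
by rewrite !laplace_antitone // (le_trans d0).
Qed.

Section part1.
Context (k : nat) (L : randvar R) (L0 : forall w, 0 <= L w).
Context (TL : cvg_in_law (T k) L).

Lemma T_laplace_cvg c : 0 <= c ->
  laplace (T k n) c @[n --> \oo] --> laplace L c.
Proof.
move=> c0; move/cvg_in_lawP : TL; apply; first exact: continuous_expc.
exact: bounded_expc.
Qed.

Lemma Z_moment_cvg c p : 0 <= c -> in_regime ell c p ->
  rv_ev (Z p n) (fun x => x ^+ k) @[n --> \oo] --> laplace L c.
Proof.
move=> c0 pc; apply/cvgrPdist_le => e e0.
have e20 : 0 < e / 2 by lra.
(* By [laplaceD_le] a d that works at 0 also bounds the variation of [laplace L] on both sides of
   c. *)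
have [d d0 Ld] := laplace_near0 e20 L0.
pose c1 := Num.max (c - d) 0; pose c2 := c + d.
have c10 : 0 <= c1 by rewrite /c1 le_max lexx orbT.
have c20 : 0 <= c2 by rewrite /c2; lra.
have c1c : c1 <= c by rewrite /c1 ge_max c0; lra.
have L2 : laplace L c - laplace L c2 <= e / 2.
  by apply: (le_trans (laplaceD_le _ c0 (ltW d0))).
have L1 : laplace L c1 - laplace L c <= e / 2.
  have c1d : 0 <= c - c1 by lra.
  have := laplaceD_le L c10 c1d; rewrite (addrC c1) subrK => /le_trans; apply.
  apply: le_trans Ld; rewrite lerB // laplace_antitone //.
  by rewrite lerBlDr -lerBlDl le_max lexx.
have [p01 _] := pc.
have near1 := near_ell ell_cvg 1; have near0 := nbhs_infty_gt 0%N.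
have near3 := regime_bounds ell_cvg pc c0 d0.
move/cvgrPdist_le : (T_laplace_cvg c10) => /(_ _ e20) near4.
move/cvgrPdist_le : (T_laplace_cvg c20) => /(_ _ e20) near5.
near=> n.
have n0 : (0 < n)%N by near: n.
have l1 : 1 <= ell n by near: n.
have pb : expR (- (c2 / ell n)) <= p n <= expR (- (c1 / ell n)) by near: n.
have l0 : 0 < ell n by lra.
have := Z_laplace_bounds k n0 l0 (p01 _ n0) c10 pb.
have : `|laplace L c1 - laplace (T k n) c1| <= e / 2 by near: n.
have : `|laplace L c2 - laplace (T k n) c2| <= e / 2 by near: n.
by rewrite !ler_norml; lra.
Unshelve. all: by end_near. Qed.
End part1.

(** The exponential sequence alone produces the law; [Z_moment_cvg] gives the same limit moments for
    all others in the regime. *)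
Lemma root_cluster_limit (L : nat -> randvar R) c :
  (forall k, (0 < k)%N -> (forall w, 0 <= L k w) /\ cvg_in_law (T k) (L k)) ->
  0 <= c ->
  exists Y, rv_within 0 1 Y /\
    forall k, (0 < k)%N -> rv_ev Y (fun x => x ^+ k) = laplace (L k) c.
Proof.
move=> HL c0; pose p n := expR (- (c / ell n)).
have pc : in_regime ell c p by exact: expR_in_regime.
have Zk k : (0 < k)%N ->
    rv_ev (Z p n) (fun x => x ^+ k) @[n --> \oo] --> laplace (L k) c.
  by move=> /HL[L0 TL]; exact: Z_moment_cvg.
have [k|Y [Y01 YZ]] := moment_limit (@Z_within p).
  have [->|/Zk/cvgP //] := posnP k.
  have ev1 n : rv_ev (Z p n) (fun x => x ^+ 0) = 1 by exact: (ev_cst _ 1).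
  by under eq_fun do rewrite ev1; exact: is_cvg_cst.
exists Y; split => // k k0.
exact: (cvg_unique _ (YZ k) (Zk k k0)).
Qed.

(** Markov's inequality for 1 - G(c) >= 0: eps times the indicator of the event is at most 1 -
    G(c). *)
Lemma cvg_to_one_of_mean (G : R -> randvar R) :
  (forall c, 0 <= c -> rv_within 0 1 (G c)) ->
  (forall e, 0 < e -> exists2 d, 0 < d &
     forall c, 0 <= c -> c <= d -> 1 - rv_ev (G c) id <= e) ->
  cvg_to_one_in_prob G.
Proof.
move=> G01 Gm eps eps0.
pose A c := [set w | eps < `|G c w - 1|].
have mA c : measurable (A c) by exact: measurable_dist_gt.
apply/fine_cvgP; split; first by apply: nearW => c; exact: fin_num_measure.
apply/cvgrPdist_le => e e0.
have [d d0 Hd] := Gm _ (mulr_gt0 e0 eps0).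
near=> c.
have c0 : 0 < c by near: c; exact: nbhs_right_gt.
have cd : c <= d by near: c; exact: nbhs_right_le.
rewrite /= -ev_indic //= sub0r normrN ger0_norm; last first.
  by apply: ev_ge0 => w; rewrite indicE.
rewrite -(ler_pM2r eps0); apply: le_trans (Hd c (ltW c0) cd).
have bG := rv_within_bounded (G01 c (ltW c0)).
rewrite /rv_ev -[X in _ <= X - _](ev_cst (rv_prob (G c))) -evB //.
  2: exact: bounded_mfun_cst.
have bA : bounded_mfun (\1_(A c) : rv_space (G c) -> R).
  by apply: bounded_mfun_indic; exact: mA.
rewrite mulrC -evZ //.
apply: ev_le => [||w].
- by apply: bounded_mfunM => //; exact: bounded_mfun_cst.
- by apply: bounded_mfunB => //; exact: bounded_mfun_cst.
- have /andP[G0 G1] := G01 c (ltW c0) w.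
  have [Aw|Aw] := pselect (A c w).
    have -> : \1_(A c) w = 1 :> R by rewrite indicE mem_set.
    by move: Aw; rewrite /A /= distrC ger0_norm; lra.
  have -> : \1_(A c) w = 0 :> R by rewrite indicE memNset.
  by rewrite mulr0 subr_ge0.
Unshelve. all: by end_near. Qed.

Lemma law_of_root_cluster (L : nat -> randvar R) :
  (forall k, (0 < k)%N -> (forall w, 0 <= L k w) /\ cvg_in_law (T k) (L k)) ->
  exists G : R -> randvar R,
    (forall c, 0 <= c ->
      [/\ forall p, in_regime ell c p -> cvg_in_law (X p) (G c),
          ~ {ae rv_prob (G c), forall w, G c w = 0},
          forall k, (0 < k)%N ->
            rv_expect (G c) (fun x => x ^+ k) =
            rv_expect (L k) (fun x => expR (- (c * x)))
        & forall Y : randvar R,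
            (forall k, (0 < k)%N ->
              rv_expect Y (fun x => x ^+ k) =
              rv_expect (L k) (fun x => expR (- (c * x)))) ->
            same_law Y (G c)]) /\
    cvg_to_one_in_prob G.
Proof.
move=> HL.
have /choice[G HG] : forall c, exists Y, 0 <= c -> rv_within 0 1 Y /\
    forall k, (0 < k)%N -> rv_ev Y (fun x => x ^+ k) = laplace (L k) c.
  move=> c; have [c0|c0] := leP 0 c.
    by have [Y HY] := root_cluster_limit HL c0; exists Y.
  (* For negative c any variable will do; the one for parameter 0 is a placeholder. *)
  by have [Y HY] := root_cluster_limit HL (lexx 0); exists Y.
have Lexp c k : 0 <= c -> (0 < k)%N ->
    rv_expect (L k) (fun x => expR (- (c * x))) = (laplace (L k) c)%:E.
  move=> c0 k0; have [L0 _] := HL k k0.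
  rewrite /laplace -rv_expectE; last exact: bounded_mfun_expc.
  rewrite /rv_expect; congr ('E__[_])%E; apply/funext => w /=.
  by rewrite /expc ger0_norm.
have Gexp c k : 0 <= c -> (0 < k)%N ->
    rv_expect (G c) (fun x => x ^+ k) = (laplace (L k) c)%:E.
  move=> c0 k0; have [G01 Gk] := HG c c0.
  rewrite rv_expectE ?Gk //.
  by apply: bounded_mfunX; exact: rv_within_bounded G01.
exists G; split=> [c c0|].
  have [G01 Gk] := HG c c0.
  split.
  - move=> p pc; apply/cvg_in_lawP => f cf bf.
    have G02 : rv_within 0 2 (G c) by move=> w; have := G01 w; lra.
    have lt02 : 0 < 2 :> R by lra.
    apply: (moments_cvg_ev cf lt02 (@X_within p) G02) => k k0.
    rewrite Gk //; apply/X_moments_cvg.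
    by have [L0 TL] := HL k k0; exact: Z_moment_cvg.
  - move=> G0; have [L0 _] := HL 1%N isT.
    have := laplace_gt0 c0 L0; rewrite -Gk // => /gt_eqF/eqP; apply.
    have -> : rv_ev (G c) (fun x => x ^+ 1) = fine 0%E; last by [].
    rewrite /rv_ev /ev unlock; congr fine.
    rewrite -[RHS](integral0 (rv_prob (G c)) setT).
    have mG : measurable_fun setT (fun w => (G c w ^+ 1)%:E).
      by apply/measurable_EFinP; exact: measurable_funX.
    apply: ae_eq_integral => //; case: G0 => N [mN N0 GN].
    exists N; split => //.
    move=> w /= Hw; apply: GN => /= Gw; apply: Hw => _.
    by rewrite Gw expr1.
  - by move=> k k0; rewrite Gexp // Lexp.
  - move=> Y Yk; apply: same_law_moments G01 _ => k k0.
    by rewrite Yk // Lexp // Gexp.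
apply: cvg_to_one_of_mean => [c /HG[]//|e e0].
have [L0 _] := HL 1%N isT.
have [d d0 Ld] := laplace_near0 e0 L0; exists d => // c c0 cd.
have [_ /(_ 1%N isT)] := HG c c0; rewrite /rv_ev; under eq_fun do rewrite expr1.
move=> ->; apply: le_trans Ld; rewrite lerB // laplace_antitone //.
Qed.

Lemma law_of_reduced_length (G : R -> randvar R) (k : nat) :
  (forall c, 0 < c -> (forall w, 0 <= G c w <= 1) /\
    forall p, in_regime ell c p -> cvg_in_law (X p) (G c)) ->
  cvg_to_one_in_prob G -> (0 < k)%N ->
  exists L : randvar R,
    [/\ forall w, 0 <= L w,
        cvg_in_law (T k) L
      & forall c, 0 < c ->
          rv_expect L (fun x => expR (- (c * x))) =
          rv_expect (G c) (fun x => x ^+ k)].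
Proof.
move=> HG G1 k0; pose psi c := rv_ev (G c) (fun x => x ^+ k).
have k0' : 0 < k%:R :> R by rewrite ltr0n.
have bGk c j : 0 < c -> bounded_mfun (fun w => G c w ^+ j).
  by move=> /HG[G01 _]; apply: bounded_mfunX; exact: rv_within_bounded G01.
have T_psi c : 0 < c -> laplace (T k n) c @[n --> \oo] --> psi c.
  move=> c0; have [G01 XG] := HG c c0.
  pose p n := expR (- (c / ell n)).
  have pc : in_regime ell c p by apply: expR_in_regime => //; exact: ltW.
  (* Convergence in law tests bounded functions only; [f] is bounded and equals x ^ k on [0, 2],
     where the variables live. *)
  pose f (x : R) : R := (2 * clip01 (x / 2)) ^+ k.
  have cf : continuous f.
    move=> x; apply: (@continuous_comp _ _ _
      (fun x : R => 2 * clip01 (x / 2)) (fun x : R => x ^+ k)).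
      2: exact: exprn_continuous.
    apply: cvgMr.
    apply: (@continuous_comp _ _ _ (fun x : R => x / 2) (@clip01 R)).
      by apply: cvgMl; exact: cvg_id.
    exact: continuous_clip01.
  have bf : bounded_fun f.
    exists (2 ^+ k); split; first exact: num_real.
    move=> B kB x _ /=; apply: le_trans (ltW kB).
    have := clip01_itv (x / 2) => x01.
    rewrite ger0_norm; last by apply: exprn_ge0; lra.
    by apply: lerXn2r; rewrite ?nnegrE; lra.
  have fE (Y : randvar R) : rv_within 0 2 Y ->
      rv_ev Y f = rv_ev Y (fun x => x ^+ k).
    move=> Y02; rewrite /rv_ev; congr (ev _ _); apply/funext => w.
    have := Y02 w => Yw; rewrite /f clip01_id; first by congr (_ ^+ _); field.
    by rewrite ler_pdivlMr ?ler_pdivrMr //; lra.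
  have Xm : rv_ev (X p n) (fun x => x ^+ k) @[n --> \oo] --> psi c.
    have G02 : rv_within 0 2 (G c) by move=> w; have := G01 w; lra.
    have /cvg_in_lawP/(_ f cf bf) := XG p pc.
    rewrite (fE _ G02); under eq_fun do rewrite (fE _ (@X_within p _)).
    exact.
  move/X_moments_cvg : Xm => Zm; apply: cvg_trans Zm; apply: near_eq_cvg.
  apply: filterS (nbhs_infty_gt 0%N) => n n0.
  by rewrite (Z_laplace k n0 (ltW c0)).
have psi_near0 e : 0 < e -> exists2 c, 0 < c & 1 - psi c <= e.
  (* 1 - G ^ k <= k (1 - G) <= k (h + 1_A), where A is the event |G - 1| > h. If A has probability
     at most h, the mean is at most 2 k h = e. *)
  move=> e0; pose h := e / (2 * k%:R).
  have h0 : 0 < h by rewrite divr_gt0 // mulr_gt0.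
  have /fine_cvgP[_ /cvgrPdist_le/(_ _ h0) near1] := G1 h h0.
  have near2 := nbhs_right_gt (0 : R).
  have [c [c0 ch]] := filter_ex (filterI near2 near1).
  exists c => //; have [G01 _] := HG c c0.
  pose A := [set w | h < `|G c w - 1|].
  have mA : measurable A by exact: measurable_dist_gt.
  have bA : bounded_mfun (\1_A : rv_space (G c) -> R).
    exact: bounded_mfun_indic.
  have evA : ev (rv_prob (G c)) \1_A <= h.
    move: ch; rewrite /= -/A -ev_indic //= sub0r normrN.
    exact: le_trans (ler_norm _).
  rewrite /psi /rv_ev -[X in X - _](ev_cst (rv_prob (G c))) -evB //; last 2 first.
  - exact: bounded_mfun_cst.
  - exact: bGk.
  apply: (@le_trans _ _ (ev (rv_prob (G c)) (fun w => k%:R * (h + \1_A w)))).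
    apply: ev_le => [||w].
    - by apply: bounded_mfunB; [exact: bounded_mfun_cst|exact: bGk].
    - apply: bounded_mfunM; first exact: bounded_mfun_cst.
      by apply: bounded_mfunD => //; exact: bounded_mfun_cst.
    - have Gw := G01 w; apply: (@le_trans _ _ (k%:R * (1 - G c w))).
        elim: (k) => [|j IH]; first by rewrite expr0 mul0r subrr.
        have /andP[g0 g1] := Gw; rewrite exprS -natr1.
        have : 0 <= (1 - G c w) * (1 - G c w ^+ j).
          by rewrite mulr_ge0 ?subr_ge0 // exprn_ile1.
        by lra.
      rewrite ler_pM2l //; have [Aw|Aw] := pselect (A w).
        have -> : \1_A w = 1 :> R by rewrite indicE mem_set.
        by lra.
      have -> : \1_A w = 0 :> R by rewrite indicE memNset.
      by move/negP: Aw; rewrite -leNgt ler_norml; lra.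
  rewrite evZ; last by apply: bounded_mfunD => //; exact: bounded_mfun_cst.
  rewrite evD ?ev_cst //; last exact: bounded_mfun_cst.
  apply: (@le_trans _ _ (k%:R * (h + h))); first by rewrite ler_pM2l // lerD2l.
  by rewrite le_eqVlt; apply/orP; left; apply/eqP; rewrite /h; field; lra.
have [L [L0 TL]] := laplace_continuity (@T_ge0 k) T_psi psi_near0.
exists L; split => // c c0.
have -> : rv_expect L (fun x => expR (- (c * x))) = (laplace L c)%:E.
  rewrite /laplace -rv_expectE; last by apply: bounded_mfun_expc; exact: ltW.
  rewrite /rv_expect; congr ('E__[_])%E; apply/funext => w /=.
  by rewrite /expc ger0_norm.
rewrite rv_expectE; last exact: bGk.
congr (_%:E); exact: (cvg_unique _ (T_laplace_cvg TL (ltW c0)) (T_psi c c0)).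
Qed.

End main.

Unset Implicit Arguments.

Theorem theorem1 (R : realType) (ell : nat -> R)
    (ell_ge0 : forall n, (0 < n)%N -> 0 <= ell n)
    (ell_cvg : ell n @[n --> \oo] --> +oo)
    (M : forall n, percolation_model R n) :
  (forall L : nat -> randvar R,
    (forall k, (0 < k)%N ->
      (forall w, 0 <= L k w) /\
      cvg_in_law (fun n => rv_scale (ell n)^-1 (reduced_length_rv (M n) k))
                 (L k)) ->
    exists G : R -> randvar R,
      (forall c, 0 <= c ->
        [/\ forall p, in_regime ell c p ->
              cvg_in_law
                (fun n => rv_scale n%:R^-1 (root_cluster_rv (M n) (p n)))
                (G c),
            ~ {ae rv_prob (G c), forall w, G c w = 0},
            forall k, (0 < k)%N ->
              rv_expect (G c) (fun x => x ^+ k) =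
              rv_expect (L k) (fun x => expR (- (c * x)))
          & forall Y : randvar R,
              (forall k, (0 < k)%N ->
                rv_expect Y (fun x => x ^+ k) =
                rv_expect (L k) (fun x => expR (- (c * x)))) ->
              same_law Y (G c)]) /\
      cvg_to_one_in_prob G) /\
  (forall G : R -> randvar R,
    (forall c, 0 < c ->
      (forall w, 0 <= G c w <= 1) /\
      forall p, in_regime ell c p ->
        cvg_in_law (fun n => rv_scale n%:R^-1 (root_cluster_rv (M n) (p n)))
                   (G c)) ->
    cvg_to_one_in_prob G ->
    forall k, (0 < k)%N ->
      exists L : randvar R,
        [/\ forall w, 0 <= L w,
            cvg_in_law (fun n => rv_scale (ell n)^-1 (reduced_length_rv (M n) k))
                       L
          & forall c, 0 < c ->
              rv_expect L (fun x => expR (- (c * x))) =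
              rv_expect (G c) (fun x => x ^+ k)]).
Proof.
split=> [L HL|G HG G1 k k0].
  exact: law_of_root_cluster.
exact: law_of_reduced_length.
Qed.
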